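(* There exists a polynomial-time algorithm to compute the Shapley value of parking games: given a positive integer $n$ and a parking function $\alpha=(a_1,\dots,a_n)\in \mathrm{PF}_n$, it computes $\phi_j(c_\alpha)$ for every $j\in[n]$ in time polynomial in $n$. Namely, it is the algorithm that, with $\alpha'=(a_1',\dots,a_n')$ the weakly increasing rearrangement of $\alpha$, $r$ a rank function for $\alpha$, and $i=r(j)$, evaluates $$\phi_j(c_\alpha)=\frac{1}{n!}\sum_{s=1}^{a_i'}\sum_{t=a_i'}^{n-1}(t-a_i'+1)\,\mathcal{Q}(\alpha'_{\hat i},s,t,t-s+1)\,\mathcal{R}(\alpha'_{\hat i},s,t),$$ $$\mathcal{R}(\alpha'_{\hat i},s,t)=\sum_{\lambda=0}^{\Lambda_t(\alpha'_{\hat i})}\ \sum_{\gamma=0}^{\Gamma_s(\alpha'_{\hat i})}\binom{\Lambda_t(\alpha'_{\hat i})}{\lambda}\mathcal{Q}(\alpha'_{\hat i},1,s-2,\gamma)\,(t-s+1+\lambda+\gamma)!\,(n-t+s-\lambda-\gamma-2)!,$$ where the values of $\mathcal{Q}$ are evaluated by dynamic programming using the recursion (cases applied in order from the top) $$\mathcal{Q}(\beta',s,t,k)=\begin{cases}1,&\text{if }k=0,\\ 0,&\text{if }k>t-s+1\text{ or }k>|\beta'|,\\ \mathcal{Q}(\beta'_{\hat 1},s,t,k),&\text{if }b_1'<s,\\ \mathcal{Q}(\beta',s+1,t,k),&\text{if }b_1'>s,\\ \mathcal{Q}(U(\beta')_{\hat 1},s+1,t,k-1)+\mathcal{Q}(\beta'_{\hat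 1},s,t,k),&\text{if }b_1'=s.\end{cases}$$
   Context: Write $[k]=\{1,\dots,k\}$; $\mathfrak{S}_n$ is the symmetric group on $[n]$. Parking process: there is a one-way street with $m$ spots numbered $1,\dots,m$, and $k\le m$ cars $1,\dots,k$ arrive one at a time in this order, with preferences $\beta=(b_1,\dots,b_k)\in[m]^k$. Upon arrival, car $i$ parks in the first unoccupied spot at or past $b_i$, if one exists; otherwise the process fails. $\mathrm{PF}_{k,m}\subseteq[m]^k$ is the set of tuples for which all cars are able to park, and $\mathrm{PF}_n=\mathrm{PF}_{n,n}$. For $\beta\in \mathrm{PF}_{k,m}$, with car $i$ parking in spot $p_i$, the total displacement is $d(\beta)=\sum_{i=1}^k(p_i-b_i)$ (and $0$ for the empty tuple); it does not depend on the order of the entries of $\beta$. Parking game: for $\alpha=(a_1,\dots,a_n)\in \mathrm{PF}_n$, $c_\alpha(S)=d((a_i:i\in S))$ for $S\subseteq[n]$, where $(a_i:i\in S)\in \mathrm{PF}_{|S|,n}$. Shapley value: for a function $c$ from subsets of $[n]$ to $\mathbb{R}$ with $c(\emptyset)=0$, $$\phi_i(c)=\frac{1}{n!}\sum_{\pi\in\mathfrak{S}_n}\Big(c(\{j\in[n]:\pi(j)\le\pi(i)\})-c(\{j\in[n]:\pi(j)<\pi(i)\})\Big),\quad i\in[n].$$ Rank function: a bijection $r:[n]\to[n]$ with $a_j=a'_{r(j)}$ for all $j$ (ties broken arbitrarily). Tuple notation: for a tuple $\beta$ of positive integers, $|\beta|$ is its length, $\beta_{\hat i}$ is $\beta$ with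 its $i$th entry removed, $\Lambda_t(\beta)$ is the number of entries (with multiplicity) that are $\ge t+2$, $\Gamma_s(\beta)$ is the number of entries (with multiplicity) that are $\le s-2$, and, for nonempty $\beta$ with smallest entry $b^*$, $U(\beta)$ is obtained from $\beta$ by replacing each entry $b$ by $\max\{b,1+b^*\}$. For a weakly increasing tuple $\beta'=(b_1',\dots,b'_{|\beta'|})$ of positive integers, $\mathcal{Q}(\beta',s,t,k)$ is the number of size-$k$ sub-tuples of $\beta'$ whose cars all park within spots $s,\dots,t$: that is, the number of index tuples $i_1<i_2<\dots<i_k$ in $[|\beta'|]$ such that $b'_{i_1}\ge s$ and $(b'_{i_1}-s+1,\dots,b'_{i_k}-s+1)\in \mathrm{PF}_{k,t-s+1}$. Conventions: $\mathcal{Q}(\beta',s,t,0)=1$ always (also when $t<s$), and $\mathcal{Q}(\beta',s,t,k)=0$ if $k>\max\{t-s+1,0\}$. A summand in which a factor $\mathcal{Q}$ is $0$ is taken to be $0$ (so factorials of negative integers never matter). *)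

(* Defs.v *)
From mathcomp Require Import all_boot all_order all_fingroup all_algebra.
From mathcomp Require Import reals.
From Stdlib Require String.
Import String.StringSyntax.

Set Implicit Arguments.
Unset Strict Implicit.
Unset Printing Implicit Defensive.

Import GRing.Theory Num.Theory.

(* Tuples of positive integers are sequences of natural numbers.  Spots, tuple
   entries and the parameters n, s, t, k keep their values; positions in a tuple
   and the elements of [n] (cars, ranks) are 0-based, with 'I_n for [n]. *)

(* The spots taken by the cars with preferences [b], in order of arrival, on a
   street with spots 1, ..., m where the spots of [occ] are already taken;
   [None] if some car fails to park. *)
Fixpoint park (m : nat) (occ b : seq nat) : option (seq nat) :=
  if b is b1 :: b' then
    if [seq p <- iota b1 (m.+1 - b1) | p \notin occ] is p :: _ then
      omap (cons p) (park m (p :: occ) b')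
    else None
  else Some [::].

(* No tuple of length k > m passes the test, so k <= m is implied. *)
Definition PF (k m : nat) : pred (seq nat) :=
  fun b => [&& size b == k, all (fun x => 0 < x <= m) b & isSome (park m [::] b)].

(* Each p_i - b_i below is a true subtraction, since p_i >= b_i. *)
Definition displacement (m : nat) (b : seq nat) : nat :=
  if park m [::] b is Some ps then \sum_(pb <- zip ps b) (pb.1 - pb.2) else 0.

(* [enum I] lists the ordinals of [I] in increasing order. *)
Definition subtuple (b : seq nat) (m : nat) (I : {set 'I_m}) : seq nat :=
  [seq nth 0 b (val i) | i <- enum I].

Definition game_cost (n : nat) (a : n.-tuple nat) (S : {set 'I_n}) : nat :=
  displacement n (subtuple a S).

Definition shapley (R : realType) (n : nat) (c : {set 'I_n} -> R) (i : 'I_n) : R :=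
  ((n`!)%:R^-1 * \sum_(pi : 'S_n)
     (c [set j | (pi j <= pi i)%N] - c [set j | (pi j < pi i)%N]))%R.

Definition rearrangement (a : seq nat) : seq nat := sort leq a.

Definition is_rank (n : nat) (a : n.-tuple nat) (r : {perm 'I_n}) : Prop :=
  forall j : 'I_n, tnth a j = nth 0 (rearrangement a) (r j).

Definition remove_at (b : seq nat) (i : nat) : seq nat := take i b ++ drop i.+1 b.

Definition Lam (t : nat) (b : seq nat) : nat := count (fun x => t + 2 <= x) b.

(* x <= s - 2 over the integers, also for s < 2 *)
Definition Gam (s : nat) (b : seq nat) : nat := count (fun x => x + 2 <= s) b.

Definition smallest (b : seq nat) : nat := foldr minn (head 0 b) b.

Definition U (b : seq nat) : seq nat := [seq maxn x (1 + smallest b) | x <- b].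

(* Index tuples i_1 < ... < i_k are k-subsets of the index set.  t.+1 - s is
   max(t - s + 1, 0), so Q b s t k is 1 for k = 0 and 0 for k > max(t - s + 1, 0).
   The upper end t = s - 2 = -1, which occurs for s = 1, is rendered by the equally
   empty range 1, ..., 0. *)
Definition Q (b : seq nat) (s t k : nat) : nat :=
  #|[set I : {set 'I_(size b)} | [&& #|I| == k,
       all (leq s) (subtuple b I)
     & PF k (t.+1 - s) [seq x - s + 1 | x <- subtuple b I]]]|.

(* In every term with nonzero Q factors, t - s + 1 + l + g <= n - 1, and there
   the subtractions are those of the integers; the other terms are 0. *)
Definition Rsum (n : nat) (b : seq nat) (s t : nat) : nat :=
  \sum_(0 <= l < (Lam t b).+1) \sum_(0 <= g < (Gam s b).+1)
     'C(Lam t b, l) * Q b 1 (s - 2) g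
       * (t.+1 - s + l + g)`! * (n + s - (t + l + g + 2))`!.

(* n! times the value of the formula for the entry at position i of the weakly
   increasing tuple a' *)
Definition formula_sum (n : nat) (a' : seq nat) (i : nat) : nat :=
  let ai := nth 0 a' i in
  let b := remove_at a' i in
  \sum_(1 <= s < ai.+1) \sum_(ai <= t < n)
     (t - ai + 1) * Q b s t (t.+1 - s) * Rsum n b s t.

Definition Q_recursion (b : seq nat) (s t k : nat) : nat :=
  if k == 0 then 1
  else if (t.+1 - s < k) || (size b < k) then 0
  else if head 0 b < s then Q (behead b) s t k
  else if s < head 0 b then Q b s.+1 t k
  else Q (behead (U b)) s.+1 t (k - 1) + Q (behead b) s t k.

(* The model of computation is a first-order, call-by-value, purely functional
   language over natural numbers and immutable cons cells.  Evaluating a node of an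
   expression costs 1 plus, for an arithmetic operation, an estimate of its bit
   operations: the sum of the bit lengths of the operands for +, -, <= and ==, and
   their product for * and division.  Cells are passed by reference, so building,
   inspecting or passing one has constant cost.  Time in this model is polynomially
   related to time on a Turing machine. *)

Notation string := String.string.
Delimit Scope string_scope with string.

Inductive value := VNum of nat | VNil | VCons of value & value.

Inductive op1 := Hd | Tl | Isnil.
Inductive op2 := Add | Sub | Mul | Div | Leq | Eqn | Cons.

Inductive expr :=
  | Var of string
  | Num of nat
  | Null
  | Op1 of op1 & expr
  | Op2 of op2 & expr & expr
  | Let of string & expr & expr
  | If of expr & expr & expr
  | Call of string & seq expr.

(* name, parameters, body *)
Definition fundef : Type := string * seq string * expr.
Definition program : Type := seq fundef.

Definition bits (n : nat) : nat := (trunc_log 2 n).+1.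

Definition eval1 (o : op1) (v : value) : option (value * nat) :=
  match o, v with
  | Hd, VCons x _ => Some (x, 0)
  | Tl, VCons _ y => Some (y, 0)
  | Isnil, VNil => Some (VNum 1, 0)
  | Isnil, VCons _ _ => Some (VNum 0, 0)
  | _, _ => None
  end.

Definition eval2 (o : op2) (v w : value) : option (value * nat) :=
  match o, v, w with
  | Cons, _, _ => Some (VCons v w, 0)
  | Add, VNum m, VNum n => Some (VNum (m + n), bits m + bits n)
  | Sub, VNum m, VNum n => Some (VNum (m - n), bits m + bits n)
  | Leq, VNum m, VNum n => Some (VNum (m <= n), bits m + bits n)
  | Eqn, VNum m, VNum n => Some (VNum (m == n), bits m + bits n)
  | Mul, VNum m, VNum n => Some (VNum (m * n), bits m * bits n)
  | Div, VNum m, VNum n => Some (VNum (m %/ n), bits m * bits n)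
  | _, _, _ => None
  end.

(* Sequencing of costed computations; [None] is a run-time error. *)
Definition bindc (A B : Type) (x : option (A * nat)) (f : A -> option (B * nat)) :
    option (B * nat) :=
  if x is Some (a, c) then
    if f a is Some (b, c') then Some (b, c + c') else None
  else None.

Definition tick (A : Type) (x : option (A * nat)) : option (A * nat) :=
  bindc (Some (tt, 1)) (fun _ => x).

Definition lookup (env : seq (string * value)) (x : string) : option value :=
  ohead [seq p.2 | p <- env & String.eqb x p.1].

Definition find_fun (p : program) (f : string) : option fundef :=
  ohead [seq d <- p | String.eqb f d.1.1].

(* Value and cost of an expression.  [fuel] only bounds the depth of the
   evaluation, to make the function total; exhausting it is an error. *)
Fixpoint eval (fuel : nat) (p : program) (env : seq (string * value)) (e : expr) :
    option (value * nat) :=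
  if fuel is fuel'.+1 then
    let ev := eval fuel' p in
    let fix evs es :=
      if es is e1 :: es' then
        bindc (ev env e1) (fun v => bindc (evs es') (fun vs => Some (v :: vs, 0)))
      else Some ([::], 0) in
    tick match e with
    | Var x => omap (fun v => (v, 0)) (lookup env x)
    | Num n => Some (VNum n, 0)
    | Null => Some (VNil, 0)
    | Op1 o e1 => bindc (ev env e1) (eval1 o)
    | Op2 o e1 e2 =>
        bindc (ev env e1) (fun v => bindc (ev env e2) (fun w => eval2 o v w))
    | Let x e1 e2 => bindc (ev env e1) (fun v => ev ((x, v) :: env) e2)
    | If e1 e2 e3 =>
        bindc (ev env e1) (fun v =>
          if v is VNum b then ev env (if b == 0 then e3 else e2) else None)
    | Call f es =>
        bindc (evs es) (fun vs =>
          if find_fun p f is Some (_, params, body) then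
            if size params == size vs then ev (zip params vs) body else None
          else None)
    end
  else None.

(* [p] halts on the arguments [args] of its function "main" with result [out]
   after [time] units of time. *)
Definition runs (p : program) (args : seq value) (out : value) (time : nat) : Prop :=
  exists fuel params body,
    [/\ find_fun p "main"%string = Some ("main"%string, params, body),
        size params = size args
      & eval fuel p (zip params args) body = Some (out, time)].

Definition vlist (vs : seq value) : value := foldr VCons VNil vs.
Definition vtuple (b : seq nat) : value := vlist [seq VNum x | x <- b].
Definition vfrac (num den : nat) : value := VCons (VNum num) (VNum den).

Declare Scope prog_scope.
Delimit Scope prog_scope with prog.

Coercion Var : string >-> expr.
Coercion Num : nat >-> expr.

Notation "a + b" := (Op2 Add a b) : prog_scope.
Notation "a - b" := (Op2 Sub a b) : prog_scope.
Notation "a * b" := (Op2 Mul a b) : prog_scope.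
Notation "a %/ b" := (Op2 Div a b) : prog_scope.
Notation "a <= b" := (Op2 Leq a b) : prog_scope.
Notation "a < b" := (Op2 Leq (Op2 Add a (Num 1)) b) : prog_scope.
Notation "a == b" := (Op2 Eqn a b) : prog_scope.
Notation "a && b" := (If a b (Num 0)) : prog_scope.
Notation "a || b" := (If a (Num 1) b) : prog_scope.
Notation hd := (Op1 Hd).
Notation tl := (Op1 Tl).
Notation isnil := (Op1 Isnil).
Notation cons_ := (Op2 Cons).
Notation "'IF' a 'THEN' b 'ELSE' c" := (If a b c)
  (at level 200, a, b, c at level 200) : prog_scope.
Notation "'LET' x ':=' a 'IN' b" := (Let x a b)
  (at level 200, x at level 0, a at level 200, b at level 200) : prog_scope.
Notation "f '$(' x , .. , y ')'" := (Call f (@cons expr x .. (@cons expr y nil) ..))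
  (at level 10, x, y at level 200) : prog_scope.
Notation "'FUN' f '(' x , .. , y ')' '=' e" :=
  ((f, @cons string x .. (@cons string y nil) .., e) : fundef)
  (at level 200, f at level 0, x, y at level 0, e at level 200) : prog_scope.

Section Program.
Local Open Scope string_scope.
Local Open Scope prog_scope.

Definition list_functions : program := [::
  FUN "length" ("l") =
    IF isnil "l" THEN 0 ELSE 1 + "length" $( tl "l" );
  FUN "nth" ("l", "i") =
    IF "i" == 0 THEN hd "l" ELSE "nth" $( tl "l", "i" - 1 );
  FUN "remove_at" ("l", "i") =
    IF "i" == 0 THEN tl "l"
    ELSE cons_ (hd "l") ("remove_at" $( tl "l", "i" - 1 ));
  FUN "insert" ("x", "l") =
    IF isnil "l" THEN cons_ "x" Null
    ELSE IF "x" <= hd "l" THEN cons_ "x" "l"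
    ELSE cons_ (hd "l") ("insert" $( "x", tl "l" ));
  FUN "sort" ("l") =
    IF isnil "l" THEN Null ELSE "insert" $( hd "l", "sort" $( tl "l" ) );
  FUN "count_lt" ("x", "l") =
    IF isnil "l" THEN 0
    ELSE (IF hd "l" < "x" THEN 1 ELSE 0) + "count_lt" $( "x", tl "l" );
  FUN "count_eq" ("x", "l") =
    IF isnil "l" THEN 0
    ELSE (IF hd "l" == "x" THEN 1 ELSE 0) + "count_eq" $( "x", tl "l" );
  FUN "equal" ("l", "l'") =
    IF isnil "l" THEN isnil "l'"
    ELSE IF isnil "l'" THEN 0
    ELSE (hd "l" == hd "l'") && "equal" $( tl "l", tl "l'" );
  FUN "max_all" ("x", "l") =
    IF isnil "l" THEN Null
    ELSE cons_ (IF hd "l" <= "x" THEN "x" ELSE hd "l") ("max_all" $( "x", tl "l" ))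
].

(* Dynamic programming: "Qmemo" evaluates the recursion while threading a table
   "T" of the values found so far, a list of entries (b . (s . (t . (k . value)))).
   It returns (value . new table).  "find" returns a list with the stored value,
   or the empty list. *)
Definition Q_functions : program := [::
  FUN "find" ("T", "b", "s", "t", "k") =
    IF isnil "T" THEN Null
    ELSE LET "e" := hd "T" IN
      IF ("k" == hd (tl (tl (tl "e")))) && (("s" == hd (tl "e"))
         && (("t" == hd (tl (tl "e"))) && ("equal" $( "b", hd "e" ))))
      THEN cons_ (tl (tl (tl (tl "e")))) Null
      ELSE "find" $( tl "T", "b", "s", "t", "k" );
  FUN "store" ("b", "s", "t", "k", "res") =
    cons_ (hd "res")
          (cons_ (cons_ "b" (cons_ "s" (cons_ "t" (cons_ "k" (hd "res"))))) (tl "res"));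
  FUN "Qmemo" ("b", "s", "t", "k", "T") =
    IF "k" == 0 THEN cons_ 1 "T"
    ELSE IF (("t" + 1) - "s" < "k") || ("length" $( "b" ) < "k") THEN cons_ 0 "T"
    ELSE LET "found" := "find" $( "T", "b", "s", "t", "k" ) IN
      IF isnil "found" THEN "store" $( "b", "s", "t", "k",
        IF hd "b" < "s" THEN "Qmemo" $( tl "b", "s", "t", "k", "T" )
        ELSE IF "s" < hd "b" THEN "Qmemo" $( "b", "s" + 1, "t", "k", "T" )
        ELSE
          LET "x" := "Qmemo" $( "max_all" $( 1 + hd "b", tl "b" ),
                                "s" + 1, "t", "k" - 1, "T" ) IN
          LET "y" := "Qmemo" $( tl "b", "s", "t", "k", tl "x" ) IN
          cons_ (hd "x" + hd "y") (tl "y") )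
      ELSE cons_ (hd "found") "T";
  FUN "Q" ("b", "s", "t", "k") =
    hd ("Qmemo" $( "b", "s", "t", "k", Null ))
].

(* Sums are evaluated by recursion, from the largest value of the index down. *)
Definition formula_functions : program := [::
  FUN "fact" ("m") =
    IF "m" == 0 THEN 1 ELSE "m" * "fact" $( "m" - 1 );
  FUN "binom" ("m", "l") =
    "fact" $( "m" ) %/ ("fact" $( "l" ) * "fact" $( "m" - "l" ));
  FUN "Lam" ("t", "b") =
    IF isnil "b" THEN 0
    ELSE (IF "t" + 2 <= hd "b" THEN 1 ELSE 0) + "Lam" $( "t", tl "b" );
  FUN "Gam" ("s", "b") =
    IF isnil "b" THEN 0
    ELSE (IF hd "b" + 2 <= "s" THEN 1 ELSE 0) + "Gam" $( "s", tl "b" );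
  FUN "Rsum_g" ("n", "b", "s", "t", "l", "g") =
    (("binom" $( "Lam" $( "t", "b" ), "l" ) * "Q" $( "b", 1, "s" - 2, "g" ))
      * ("fact" $( ((("t" + 1) - "s") + "l") + "g" )
         * "fact" $( ("n" + "s") - ((("t" + "l") + "g") + 2) )))
    + (IF "g" == 0 THEN 0 ELSE "Rsum_g" $( "n", "b", "s", "t", "l", "g" - 1 ));
  FUN "Rsum_l" ("n", "b", "s", "t", "l") =
    "Rsum_g" $( "n", "b", "s", "t", "l", "Gam" $( "s", "b" ) )
    + (IF "l" == 0 THEN 0 ELSE "Rsum_l" $( "n", "b", "s", "t", "l" - 1 ));
  FUN "Rsum" ("n", "b", "s", "t") =
    "Rsum_l" $( "n", "b", "s", "t", "Lam" $( "t", "b" ) );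
  FUN "formula_t" ("n", "ai", "b", "s", "t") =
    IF "t" < "ai" THEN 0
    ELSE ((("t" - "ai") + 1) * "Q" $( "b", "s", "t", ("t" + 1) - "s" ))
           * "Rsum" $( "n", "b", "s", "t" )
         + "formula_t" $( "n", "ai", "b", "s", "t" - 1 );
  FUN "formula_s" ("n", "ai", "b", "s") =
    IF "s" == 0 THEN 0
    ELSE "formula_t" $( "n", "ai", "b", "s", "n" - 1 )
         + "formula_s" $( "n", "ai", "b", "s" - 1 );
  FUN "formula" ("n", "a'", "i") =
    LET "ai" := "nth" $( "a'", "i" ) IN
    "formula_s" $( "n", "ai", "remove_at" $( "a'", "i" ), "ai" )
].

(* "main" takes n and the tuple a, and returns the list over j of the fractions
   (numerator . denominator) that represent the Shapley values.  "shapley_from"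
   runs through the entries a_j, with "seen" the list of the entries before a_j;
   the rank of j is the number of entries smaller than a_j plus the number of
   entries equal to a_j before it. *)
Definition shapley_program : program :=
  list_functions ++ Q_functions ++ formula_functions ++ [::
  FUN "shapley_from" ("n", "a", "a'", "rest", "seen") =
    IF isnil "rest" THEN Null
    ELSE LET "aj" := hd "rest" IN
      LET "i" := "count_lt" $( "aj", "a" ) + "count_eq" $( "aj", "seen" ) IN
      cons_ (cons_ ("formula" $( "n", "a'", "i" )) ("fact" $( "n" )))
            ("shapley_from" $( "n", "a", "a'", tl "rest", cons_ "aj" "seen" ));
  FUN "main" ("n", "a") =
    "shapley_from" $( "n", "a", "sort" $( "a" ), "a", Null )
].

End Program.

(* Main.v *)
(* Let overflow(v) be the number of cars that drive past spot v.  It satisfies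
   overflow(v) = max(overflow(v-1) + #(cars preferring v) - 1, 0), all cars park iff
   it vanishes at the last spot, and the displacement is its sum over v.  Hence a new
   last car with preference x is displaced by t+1-x if x lies in a maximal block
   s..t of occupied spots, and by 0 if spot x is free.  In the Shapley sum, a set S of
   predecessors occurs |S|!(n-1-|S|)! times; S has the maximal block s..t iff
   nobody in S prefers s-1 or t+1, the cars preferring 1..s-2 park there, and those
   preferring s..t fill s..t, which makes the sum over S factor as in the formula.

   For the running time, the keys in the table of "Qmemo" are distinct and belong to an
   explicit universe of polynomial size.  A call that finds no entry adds one key of
   its own, so the total cost is linear in the number of keys added. *)

Require Import Defs.
From mathcomp Require Import all_boot all_order all_fingroup all_algebra.
From mathcomp Require Import reals zify.
From Stdlib Require String.
Import String.StringSyntax.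

Set Implicit Arguments.
Unset Strict Implicit.
Unset Printing Implicit Defensive.

Import GRing.Theory Num.Theory.

(** Everything is expressed by [overflow], which sees only the multiplicities of the preferences.
    Independence of the arrival order is then immediate, and sums over sets of cars become sums of
    permutation-invariant functions over [subs]. The weight |S|!(n-1-|S|)! does not factor over the
    pieces of S, so the numbers g and l of cars preferring at most s-2 and at least t+2 are fixed
    first; this is the origin of the double sum in the formula. The program breaks ties between
    ranks by order of appearance, while the rank function of the theorem is arbitrary. The outputs
    agree, because deleting either of two equal entries of a sorted tuple leaves the same tuple. The
    time bound is N^27 with N = 4n+100. The 4n covers sums such as t-s+1+l+g under the factorials,
    and the 100 lets constant factors be absorbed by one more power of N. All numbers are at most
    2^(N^3), an operation costs at most N^9, a value of [Q] at most N^15, and each enclosing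
    recursion costs one or two further powers. *)

(** * The parking process *)

(* The number of cars preferring one of the spots u+1, ..., u+len that drive past spot
   u+len, if no other cars come. *)
Fixpoint overflow (b : seq nat) (u len : nat) : nat :=
  if len is l.+1 then (overflow b u l + count_mem (u + len) b).-1 else 0.

Definition occupied (b : seq nat) (v : nat) : bool :=
  0 < overflow b 0 v.-1 + count_mem v b.

Lemma overflow_leq b b' u len :
  (forall v, count_mem v b <= count_mem v b') ->
  overflow b u len <= overflow b' u len.
Proof.
move=> le_bb'; elim: len => //= l IHl.
have := le_bb' (u + l.+1); move: IHl => /=. lia.
Qed.

Lemma eq_overflow b b' u len :
  (forall v, u < v <= u + len -> count_mem v b = count_mem v b') ->
  overflow b u len = overflow b' u len.
Proof.
elim: len => //= l IHl eq_bb'.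
by rewrite IHl ?eq_bb' // => [|v ?]; [lia | apply: eq_bb'; lia].
Qed.

Lemma perm_overflow b b' u len :
  perm_eq b b' -> overflow b u len = overflow b' u len.
Proof. by move=> /seq.permP bb'; apply: eq_overflow => v _; apply: bb'. Qed.

Lemma overflow_shift b u k len :
  overflow b u k = 0 -> overflow b u (k + len) = overflow b (u + k) len.
Proof.
move=> b0; elim: len => [|l IHl]; first by rewrite addn0.
by rewrite addnS /= IHl !addnS addnA.
Qed.

Lemma overflow_filter (p : pred nat) b u len :
  (forall v, u < v <= u + len -> p v) ->
  overflow (filter p b) u len = overflow b u len.
Proof.
move=> pP; apply: eq_overflow => v /pP pv; rewrite count_filter.
by apply: eq_count => x /=; case: eqP => // ->; rewrite pv.
Qed.

Lemma countS_between (b : seq nat) u l :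
  count (fun x => u < x <= u + l.+1) b
  = count (fun x => u < x <= u + l) b + count_mem (u + l.+1) b.
Proof. by elim: b => //= x b ->; lia. Qed.

(** Each of the [len] spots absorbs at most one car; the other cars of the window drive past its
    end. *)
Lemma leq_overflow b u len :
  count (fun x => u < x <= u + len) b <= overflow b u len + len.
Proof.
elim: len => [|l IHl]; last by rewrite countS_between /=; lia.
by rewrite /= leqn0 addn0; elim: b => //= x b /eqP->; lia.
Qed.

Lemma overflow_balance b u len :
  overflow b 0 (u + len) + len
  = overflow b 0 u + count (fun x => u < x <= u + len) b
    + count (fun v => ~~ occupied b v) (iota u.+1 len).
Proof.
elim: len => [|l IHl].
  rewrite addn0 /= !addn0; suff ->: count (fun x => u < x <= u) b = 0 by lia.
  by elim: b => //= x b ->; lia.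
rewrite -[in iota _ _](addn1 l) iotaD count_cat countS_between addnS.
move: IHl; rewrite [count _ (iota _ 1)]/= {3}/occupied addSn /= addnS /= add0n.
lia.
Qed.

(** * Adding one car *)

Section AddCar.
Variables (l : seq nat) (x p : nat).
Hypothesis x_gt0 : 0 < x.
Hypothesis occ_xp : forall v, x <= v < p -> occupied l v.

(** The spot [p] need not be free here. For a car that finds no spot, [p] is taken one past the end
    of the street, and the overflow at the end is seen to become positive. *)
Lemma overflow_cons_lt v :
  v < p -> overflow (x :: l) 0 v = overflow l 0 v + (x <= v).
Proof.
elim: v => [|v IHv] v_lt_p /=; first lia.
rewrite IHv; last lia.
have := @occ_xp v.+1; rewrite /occupied /= add0n; lia.
Qed.

Hypothesis x_le_p : x <= p.
Hypothesis free_p : ~~ occupied l p.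

(** At the free spot [p] the predecessor in [overflow] is truncated at 0, and this truncation
    swallows the additional car. *)
Lemma overflow_cons v :
  overflow (x :: l) 0 v = overflow l 0 v + (x <= v < p).
Proof.
elim: v => [|v IHv] /=; first lia.
have free_v : p = v.+1 -> overflow l 0 v + count_mem v.+1 l = 0.
  by move=> e; move: free_p; rewrite e /occupied /=; lia.
rewrite IHv; have := @occ_xp v.+1; rewrite /occupied /= add0n.
move: free_v; move: (count_mem v.+1 l) (overflow l 0 v) => c o; lia.
Qed.

Lemma occupied_cons v : occupied (x :: l) v = occupied l v || (v == p).
Proof.
have free_v : v = p -> overflow l 0 v.-1 + count_mem v l = 0.
  by move=> ->; move: free_p; rewrite /occupied /=; lia.
have := @occ_xp v; rewrite /occupied overflow_cons /=; lia.
Qed.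

Lemma sum_overflow_cons m : p <= m ->
  \sum_(v < m) overflow (x :: l) 0 v = \sum_(v < m) overflow l 0 v + (p - x).
Proof.
move=> p_le_m; under eq_bigr do rewrite overflow_cons.
rewrite big_split /=; congr (_ + _).
suff ->: \sum_(i < m) (x <= i < p) = minn m p - x by lia.
elim: m {p_le_m} => [|m IHm]; rewrite ?big_ord0 ?big_ord_recr /=; first lia. rewrite IHm. lia.
Qed.

End AddCar.

(** The list [l] holds the preferences of the cars already parked, and the invariant is that the
    spots taken are those predicted by [occupied l]. Each car adds its displacement p - x to the sum
    of the overflows. *)
Lemma parkP m occ l b :
  (forall v, 0 < v -> (v \in occ) = occupied l v) ->
  overflow l 0 m = 0 ->
  all (fun x => 0 < x <= m) b ->
  if park m occ b is Some ps then
    overflow (b ++ l) 0 m = 0 /\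
    \sum_(pb <- zip ps b) (pb.1 - pb.2) + \sum_(v < m) overflow l 0 v
      = \sum_(v < m) overflow (b ++ l) 0 v
  else 0 < overflow (b ++ l) 0 m.
Proof.
elim: b occ l => [|x b IHb] occ l occP l0; first by rewrite /= big_nil.
move=> /= /andP[/andP[x_gt0 x_le_m] b_m].
have xbl : perm_eq (x :: (b ++ l)) (b ++ x :: l).
  by rewrite perm_sym -cat_rcons -cat_cons perm_cat2r perm_rcons.
have sum_xbl : \sum_(v < m) overflow (x :: (b ++ l)) 0 v
             = \sum_(v < m) overflow (b ++ x :: l) 0 v.
  by apply: eq_bigr => v _; apply: perm_overflow.
rewrite (perm_overflow _ _ xbl) sum_xbl.
case def_f: [seq p <- iota x (m.+1 - x) | p \notin occ] => [|p f].
  have occ_xm v : x <= v < m.+1 -> occupied l v.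
    move=> v_xm; rewrite -occP; last lia.
    apply/negPn; apply/negP => v_free.
    suff: v \in [::] by [].
    by rewrite -def_f mem_filter v_free mem_iota; lia.
  (* The process fails at this car, and the cars still to come can only enlarge the overflow. *)
  have: 0 < overflow (x :: l) 0 m by rewrite (overflow_cons_lt x_gt0 occ_xm); lia.
  move=> /leq_trans; apply; apply: overflow_leq => v.
  by rewrite count_cat leq_addl.
have: p \in p :: f by rewrite mem_head.
rewrite -def_f mem_filter mem_iota => /andP[p_occ p_range].
have free_p : ~~ occupied l p by rewrite -occP //; lia.
have occ_xp v : x <= v < p -> occupied l v.
  move=> v_xp; rewrite -occP; last lia.
  apply/negPn; apply/negP => v_free.
  have: v \in p :: f by rewrite -def_f mem_filter v_free mem_iota; lia.
  have: sorted ltn (p :: f) by rewrite -def_f sorted_filter ?iota_ltn_sorted //; exact: ltn_trans.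
  rewrite /= (path_sortedE ltn_trans) => /andP[/allP f_gt _].
  by rewrite inE => /orP[/eqP|/f_gt /=]; lia.
have x_le_p : x <= p by lia.
have p_le_m : p <= m by lia.
have := IHb (p :: occ) (x :: l) _ _ b_m.
case: (park m (p :: occ) b) => [ps|] /= IH.
  case: IH => [v v_gt0||IH1 IH2].
  - by rewrite inE (occupied_cons x_gt0 occ_xp) // occP // orbC.
  - by rewrite -/(overflow (x :: l) 0 m) (overflow_cons x_gt0 occ_xp) // l0; lia.
  split=> //; rewrite big_cons /= -IH2 (sum_overflow_cons x_gt0 occ_xp) //.
  by rewrite addnAC addnC (addnC (p - x)).
apply: IH => [v v_gt0|]; last by rewrite (overflow_cons x_gt0 occ_xp) // l0; lia.
by rewrite inE (occupied_cons x_gt0 occ_xp) // occP // orbC.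
Qed.

Lemma occupied_nil v : occupied [::] v = false.
Proof.
rewrite /occupied /= addn0; suff ->: overflow [::] 0 v.-1 = 0 by [].
by elim: (v.-1) => //= n ->.
Qed.

Lemma overflow_nil u len : overflow [::] u len = 0.
Proof. by elim: len => //= n ->. Qed.

Lemma PF_E k m b :
  PF k m b = [&& size b == k, all (fun x => 0 < x <= m) b & overflow b 0 m == 0].
Proof.
rewrite /PF; case: eqP => //= _; case b_m: (all _ b) => //=.
have occ0 v : 0 < v -> (v \in [::]) = occupied [::] v by rewrite occupied_nil.
have := parkP occ0 (overflow_nil 0 m) b_m; rewrite cats0.
by case: park => [ps [-> _]|/lt0n_neq0/negPf->].
Qed.

Lemma displacementE k m b :
  PF k m b -> displacement m b = \sum_(v < m) overflow b 0 v.
Proof.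
rewrite /PF /displacement => /and3P[_ b_m].
have occ0 v : 0 < v -> (v \in [::]) = occupied [::] v by rewrite occupied_nil.
have := parkP occ0 (overflow_nil 0 m) b_m; rewrite cats0.
case: park => // ps [_ <-] _; rewrite [X in _ + X]big1 ?addn0 // => v _.
exact: overflow_nil.
Qed.

(** * Subsequences and the recursion for Q *)

(** One item per set of positions: equal entries of [b] yield repeated items, so sums over [subs b]
    count index tuples with multiplicity, as [Q] and the game do. *)
Fixpoint subs (T : Type) (b : seq T) : seq (seq T) :=
  if b is x :: b' then subs b' ++ map (cons x) (subs b') else [:: [::]].

Lemma sum_subs_cons (T : Type) (F : seq T -> nat) x b :
  \sum_(c <- subs (x :: b)) F c
  = \sum_(c <- subs b) F c + \sum_(c <- subs b) F (x :: c).
Proof. by rewrite big_cat big_map. Qed.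

Lemma subs_map (T T' : Type) (f : T -> T') b : subs (map f b) = map (map f) (subs b).
Proof. by elim: b => //= x b ->; rewrite map_cat -!map_comp. Qed.

Lemma mem_subs (T : eqType) (b c : seq T) : c \in subs b -> subseq c b.
Proof.
elim: b c => [|x b IHb] c /=; first by rewrite inE.
rewrite mem_cat => /orP[/IHb cb|/mapP[d /IHb db ->]]; last by rewrite /= eqxx.
exact: subseq_trans cb (subseq_cons _ _).
Qed.

Definition perm_invariant (T : eqType) (F : seq T -> nat) :=
  forall c d, perm_eq c d -> F c = F d.

Lemma perm_invariant_cons (T : eqType) (F : seq T -> nat) x :
  perm_invariant F -> perm_invariant (fun c => F (x :: c)).
Proof. by move=> F_inv c d cd; apply: F_inv; rewrite perm_cons. Qed.

Lemma perm_sum_subs (T : eqType) (F : seq T -> nat) b b' :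
  perm_invariant F -> perm_eq b b' -> \sum_(c <- subs b) F c = \sum_(c <- subs b') F c.
Proof.
(* Moving an entry to the front by adjacent swaps reduces the claim to two lists with the same
   head. *)
have front x b1 b2 G : perm_invariant G ->
    \sum_(c <- subs (b1 ++ x :: b2)) G c = \sum_(c <- subs (x :: b1 ++ b2)) G c.
  elim: b1 G => [|y b1 IHb] G G_inv //.
  rewrite cat_cons !sum_subs_cons !IHb //; last exact: perm_invariant_cons.
  rewrite !sum_subs_cons addnACA; congr (_ + _ + (_ + _)).
  apply: eq_bigr => c _; apply: G_inv.
  by rewrite -[y :: x :: c]/([:: y; x] ++ c) -[x :: y :: c]/([:: x; y] ++ c) perm_cat2r perm_sym (perm_catC [:: x] [:: y]).
elim: b b' F => [|x b IHb] b' F F_inv bb'; first by rewrite perm_sym in bb'; rewrite (perm_nilP bb').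
have: x \in b' by rewrite -(perm_mem bb') mem_head.
move=> xb'; move: bb'; case/path.splitPr: b' / xb' => b1 b2 bb'.
rewrite front // !sum_subs_cons.
have bb : perm_eq b (b1 ++ b2).
  by move: bb'; rewrite perm_sym perm_catC cat_cons perm_cons perm_catC perm_sym.
by rewrite (IHb _ _ F_inv bb) (IHb _ _ (perm_invariant_cons x F_inv) bb).
Qed.

(** Invariance of [F] enters because [enum] lists a set in the order of [T]: [enum (x |: S)] is only
    a permutation of [x :: enum S]. *)
Lemma sum_subsets (T : finType) (T' : eqType) (f : T -> T') (F : seq T' -> nat) (e : seq T) :
  perm_invariant F -> uniq e ->
  \sum_(S : {set T} | S \subset e) F [seq f i | i <- enum S]
  = \sum_(c <- subs [seq f i | i <- e]) F c.
Proof.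
elim: e F => [|x e IHe] F F_inv; last case/andP=> x_e e_uniq.
  move=> _; rewrite big_seq1 (big_pred1 set0) ?enum_set0 // => S.
  rewrite /= -subset0; apply/subsetP/subsetP => sub y /sub; by rewrite ?inE.
rewrite /= sum_subs_cons -!IHe //; last exact: perm_invariant_cons.
rewrite (bigID (fun S : {set T} => x \in S)) /= addnC; congr (_ + _).
  apply: eq_bigl => S; apply/andP/idP => [[/subsetP Sxe xS]|/subsetP Se].
    apply/subsetP => y yS; have := Sxe y yS; rewrite inE => /orP[/eqP e_yx|//].
    by rewrite -e_yx yS in xS.
  split; last by apply: contra x_e => /Se.
  by apply/subsetP => y /Se ye; rewrite inE ye orbT.
rewrite (reindex_onto (fun S => x |: S) (fun S => S :\ x)) /=; last first.
  by move=> S /andP[_ xS]; rewrite setD1K.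
have E S : [&& x |: S \subset x :: e, x \in x |: S & (x |: S) :\ x == S] = (S \subset e).
  rewrite setU11 /=; apply/andP/idP => [[/subsetP sub /eqP eS]|/subsetP sub].
    apply/subsetP => y yS; have := sub y; rewrite !inE yS orbT => /(_ isT).
    case/orP=> // /eqP yx; by move: yS; rewrite -eS yx setD11.
  have xS : x \notin S by apply: contra x_e => /sub.
  split; last by rewrite setU1K.
  by apply/subsetP => y; rewrite !inE => /orP[->//|/sub->]; rewrite orbT.
rewrite (eq_bigl _ _ (fun S => etrans (esym (andbA _ _ _)) (E S))).
apply: eq_bigr => S /subsetP sub; apply: F_inv.
rewrite -[f x :: _]/(map f (x :: enum S)); apply: perm_map.
apply: uniq_perm; rewrite /= ?enum_uniq //.
  by rewrite mem_enum andbT; apply: contra x_e => /sub.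
by move=> y; rewrite inE !mem_enum !inE.
Qed.

(** The condition on sub-tuples counted by [Q], without the shift to spots 1, ..., t-s+1: the
    overflow starts at spot s instead. *)
Definition Qind (s t k : nat) (c : seq nat) : bool :=
  [&& size c == k, all (fun x => s <= x <= t) c & overflow c s.-1 (t.+1 - s) == 0].

Lemma perm_invariant_Qind s t k : perm_invariant (Qind s t k).
Proof.
move=> c d cd; rewrite /Qind (perm_size cd) (perm_overflow _ _ cd).
by rewrite (perm_all _ cd).
Qed.

Lemma QindE s t k c : 0 < s ->
  [&& size c == k, all (leq s) c & PF k (t.+1 - s) [seq x - s + 1 | x <- c]] = Qind s t k c.
Proof.
move=> s_gt0; rewrite PF_E size_map /Qind; case: eqP => //= _.
case s_c: (all (leq s) c) => /=; last first.
  suff ->: all (fun x => s <= x <= t) c = false by [].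
  by apply: contraFF s_c; apply: sub_all => x /andP[].
rewrite all_map; congr (_ && (_ == 0)).
  by apply: eq_in_all => x /(allP s_c) s_x /=; lia.
elim: (t.+1 - s) => //= l ->; congr (_ + _).-1.
rewrite count_map; apply: eq_in_count => x /(allP s_c) s_x /=; lia.
Qed.

Lemma Q_subs b s t k : 0 < s -> Q b s t k = \sum_(c <- subs b) Qind s t k c.
Proof.
move=> s_gt0; rewrite /Q -sum1_card big_mkcond /=.
have F_inv : perm_invariant (Qind s t k) by exact: perm_invariant_Qind.
have b_enum : b = [seq nth 0 b (val i) | i <- enum 'I_(size b)].
  by rewrite map_comp val_enum_ord map_nth_iota0 ?take_size.
rewrite [in RHS]b_enum -sum_subsets ?enum_uniq //.
rewrite [RHS]big_mkcond /=; apply: eq_bigr => I _.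
rewrite inE -QindE // size_map -cardE.
have -> : I \subset enum 'I_(size b) by apply/subsetP => i _; rewrite mem_enum.
by rewrite -[subtuple b I]/([seq nth 0 b (val i) | i <- enum I]); case: ifP.
Qed.

Lemma Qind_size s t k c : 0 < s -> Qind s t k c -> k <= t.+1 - s.
Proof.
move=> s_gt0 /and3P[/eqP <- st_c /eqP c0].
have := leq_overflow c s.-1 (t.+1 - s); rewrite c0.
suff -> : count (fun x => s.-1 < x <= s.-1 + (t.+1 - s)) c = size c by [].
by apply/eqP; rewrite -all_count; apply: sub_all st_c => x /=; lia.
Qed.

Lemma Q_gt_size b s t k : size b < k -> Q b s t k = 0.
Proof.
move=> b_k; apply/eqP; rewrite cards_eq0; apply/eqP/setP => I; rewrite !inE.
move: b_k; case: eqP => //= <-.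
by rewrite ltnNge -[X in _ <= X]card_ord max_card.
Qed.

Lemma Q_gt_range b s t k : 0 < s -> t.+1 - s < k -> Q b s t k = 0.
Proof.
move=> s_gt0 k_gt; rewrite Q_subs // big1 // => c _.
by case: (boolP (Qind s t k c)) => // /Qind_size -/(_ s_gt0); lia.
Qed.

Lemma Q0 b s t : 0 < s -> Q b s t 0 = 1.
Proof.
move=> s_gt0; rewrite Q_subs //.
elim: b => [|x b IHb]; first by rewrite /= big_seq1 /Qind /= overflow_nil.
by rewrite sum_subs_cons IHb big1.
Qed.

Lemma Q_lt_head x b s t k : 0 < s -> x < s -> Q (x :: b) s t k = Q b s t k.
Proof.
move=> s_gt0 x_lt; rewrite !Q_subs // sum_subs_cons [X in _ + X]big1 ?addn0 // => c _.
by rewrite /Qind /= leqNgt x_lt /= andbF.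
Qed.

Lemma all_subs (p : pred nat) b c : all p b -> c \in subs b -> all p c.
Proof. by move=> /allP pb /mem_subs/mem_subseq cb; apply/allP => x /cb/pb. Qed.

(** Nobody prefers spot s, so nothing drives past it and the window may start at s+1. The bounds on
    [k] make the window nonempty. *)
Lemma Q_gt_all b s t k :
  0 < s -> 0 < k <= t.+1 - s -> all (leq s.+1) b -> Q b s t k = Q b s.+1 t k.
Proof.
move=> s_gt0 k_range s_b; rewrite !Q_subs //; apply: eq_big_seq => c /(all_subs s_b) s_c.
congr nat_of_bool; rewrite /Qind; congr [&& _, _ & _ == 0].
  by apply: eq_in_all => x /(allP s_c); lia.
have -> : t.+1 - s = 1 + (t.+1 - s.+1) by lia.
have c0 : count_mem s c = 0.
  by apply/eqP; rewrite eqn0Ngt -has_count -all_predC; apply: sub_all s_c => x /=; lia.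
by rewrite overflow_shift /= addn1 prednK // c0.
Qed.

(** One car preferring s parks there, and the others drive on as if they preferred s+1. The window
    has to contain s+1: for the window s alone the left side would be the number of the other cars
    preferring s, and the right side 0. *)
Lemma overflow_head s c l : 0 < s -> all (leq s) c ->
  overflow (s :: c) s.-1 l.+2 = overflow (map (maxn s.+1) c) s l.+1.
Proof.
move=> s_gt0 s_c.
have count_max (v : nat) : s < v -> count_mem v (map (maxn s.+1) c)
    = (v == s.+1) * count_mem s c + count_mem v c.
  elim: c s_c => [|x c IHc] /=; first by rewrite muln0.
  case/andP=> s_x /IHc{}IHc s_v; rewrite IHc // mulnDr addnACA; congr (_ + _).
  by case: (v =P s.+1) => v_s; rewrite ?mul1n ?mul0n; lia.
elim: l => [|l IHl].
  rewrite /=; have -> : s.-1 + 1 = s by lia.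
  have -> : s.-1 + 2 = s.+1 by lia.
  have -> : s + 1 = s.+1 by lia.
  by rewrite count_max // !eqxx ltn_eqF //= mul1n.
rewrite [LHS]/= -/(overflow (s :: c) s.-1 l.+2) IHl.
rewrite [RHS]/= -/(overflow (map (maxn s.+1) c) s l.+1) (count_max (s + l.+2)); last lia.
have -> : s.-1 + l.+3 = s + l.+2 by lia.
have -> : (s + l.+2 == s.+1) = false by lia.
have -> : (s == s + l.+2) = false by lia.
by [].
Qed.

Lemma Q_eq_head b s t k : 0 < s -> k < t.+1 - s -> all (leq s) b ->
  Q (s :: b) s t k.+1 = Q (map (maxn s.+1) b) s.+1 t k + Q b s t k.+1.
Proof.
move=> s_gt0 k_range s_b; rewrite addnC !Q_subs // sum_subs_cons; congr (_ + _).
rewrite subs_map big_map; apply: eq_big_seq => c /(all_subs s_b) s_c.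
congr nat_of_bool; rewrite /Qind /= size_map eqSS; case: eqP => //= size_c.
have -> : s <= s <= t by lia.
rewrite all_map subSS.
(* For t = s the window is a single spot, to which [overflow_head] does not apply; then k = 0 and
   [c] is empty. *)
case t_s: (t - s) => [|l].
  have -> : c = [::] by apply: size0nil; rewrite size_c; lia.
  rewrite /= subSn; last lia.
  rewrite t_s /= addn1 prednK // eqxx; lia.
rewrite subSn ?t_s ?overflow_head //; last lia.
congr [&& _ & _ == 0]; apply: eq_in_all => x /(allP s_c) /=; lia.
Qed.

Lemma sorted_leq_all x b : sorted leq (x :: b) -> all (leq x) b.
Proof. by rewrite /= path_sortedE; [case/andP | exact: leq_trans]. Qed.

Lemma smallest_sorted x b : sorted leq (x :: b) -> smallest (x :: b) = x.
Proof.
move/sorted_leq_all; rewrite /smallest /=.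
suff H : all (leq x) b -> foldr minn x b = x by move=> /H ->; rewrite minnn.
by elim: b => //= y b IHb /andP[xy /IHb ->]; lia.
Qed.

Lemma behead_U x b : sorted leq (x :: b) -> behead (U (x :: b)) = map (maxn x.+1) b.
Proof.
move=> x_b; rewrite /U smallest_sorted //=; apply: eq_map => y.
by rewrite maxnC.
Qed.

Lemma Q_recursionE b s t k :
  sorted leq b -> all (leq 1) b -> 0 < s -> Q b s t k = Q_recursion b s t k.
Proof.
move=> b_sorted b_pos s_gt0; rewrite /Q_recursion.
case: k => [|k]; first by rewrite Q0.
case: (boolP (t.+1 - s < k.+1)) => [|t_k]; first exact: Q_gt_range.
case: (boolP (size b < k.+1)) => [|b_k]; first exact: Q_gt_size.
rewrite [_.+1 == 0]/= [false || false]/= subn1 [_.-1]/=.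
case: b => [|x b] // in b_sorted b_pos b_k *.
rewrite [head _ _]/= [behead (x :: b)]/=; case: (ltngtP x s) => [x_s|x_s|x_s].
- exact: Q_lt_head.
- apply: Q_gt_all => //; first lia.
  by have := sorted_leq_all b_sorted; rewrite /= x_s => /sub_all; apply => y; apply: leq_trans.
- rewrite behead_U //; rewrite {}x_s in b_sorted *.
  by rewrite Q_eq_head //; [lia | exact: sorted_leq_all].
Qed.

(** * The Shapley value *)

(** To choose a subsequence is to choose independently its part inside [p] and its part outside. *)
Lemma sum_subs_split (T : Type) (p : pred T) (F G : seq T -> nat) b :
  \sum_(c <- subs b) F (filter p c) * G (filter (predC p) c)
  = (\sum_(c <- subs (filter p b)) F c) * (\sum_(c <- subs (filter (predC p) b)) G c).
Proof.
elim: b F G => [|x b IHb] F G; first by rewrite /= !big_seq1.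
rewrite sum_subs_cons /=; case: (p x); rewrite /= sum_subs_cons IHb.
  by rewrite (IHb (fun c => F (x :: c))) mulnDl.
by rewrite (IHb F (fun c => G (x :: c))) mulnDr.
Qed.

Lemma sum_subs_filter (T : Type) (p : pred T) (F : seq T -> nat) b :
  (forall c, ~~ all p c -> F c = 0) ->
  \sum_(c <- subs (filter p b)) F c = \sum_(c <- subs b) F c.
Proof.
elim: b F => [|x b IHb] F F0 //=; rewrite sum_subs_cons -IHb //.
case: ifP => px; last by rewrite [X in _ + X]big1 ?addn0 // => c _; rewrite F0 //= px.
by rewrite sum_subs_cons (IHb (fun c => F (x :: c))) // => c pc; apply: F0; rewrite /= px.
Qed.

Lemma sum_subs_size (T : Type) (b : seq T) l :
  \sum_(c <- subs b) (size c == l) = 'C(size b, l).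
Proof.
elim: b l => [|x b IHb] l; first by rewrite big_seq1; case: l.
rewrite sum_subs_cons IHb; case: l => [|l] /=; first by rewrite big1 ?bin0.
by rewrite binS; congr (_ + _); rewrite -IHb.
Qed.

Lemma sum_subs_nil (T : Type) (b : seq T) : \sum_(c <- subs b) (size c == 0) = 1.
Proof. by rewrite sum_subs_size bin0. Qed.

(* The spots s, ..., t form a maximal block of occupied spots. *)
Definition block (c : seq nat) (s t : nat) : bool :=
  [&& ~~ occupied c s.-1, all (occupied c) (iota s (t.+1 - s)) & ~~ occupied c t.+1].

Lemma freeE c v : ~~ occupied c v = (overflow c 0 v.-1 == 0) && (count_mem v c == 0).
Proof. by rewrite /occupied -eqn0Ngt addn_eq0. Qed.

(** Spot x lies in at most one maximal block. With q the last free spot before x and p the first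
    free spot from x on, this block is s = q+1, t = p-1, and t - x + 1 is the displacement p - x. If
    p = x, the double sum vanishes. *)
Lemma sum_block c x n :
  all (leq 1) c -> 0 < x -> overflow (x :: c) 0 n = 0 -> x <= n ->
  \sum_(v < n) overflow (x :: c) 0 v
  = \sum_(v < n) overflow c 0 v
    + \sum_(1 <= s < x.+1) \sum_(x <= t < n) (t - x + 1) * block c s t.
Proof.
move=> c_pos x_gt0 xc_n x_n.
have ex_free : exists p, (x <= p) && ~~ occupied c p.
  case: (boolP (all (occupied c) (iota x (n.+1 - x)))) => [/allP occ|].
    have occ_xn v : x <= v < n.+1 -> occupied c v by move=> ?; apply: occ; rewrite mem_iota; lia.
    by have := overflow_cons_lt x_gt0 occ_xn (leqnn n.+1); rewrite xc_n x_n addn1.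
  rewrite -has_predC => /hasP[p]; rewrite mem_iota => p_range p_free.
  by exists p; move: p_free; rewrite /= => ->; rewrite andbT; lia.
case: (ex_minnP ex_free) => p /andP[x_p p_free] p_min.
have occ_xp v : x <= v < p -> occupied c v.
  move=> v_range; apply/negPn/negP => v_free; have := p_min v; rewrite v_free andbT; lia.
have p_n : p <= n.
  rewrite leqNgt; apply/negP => n_p.
  by have := overflow_cons_lt x_gt0 occ_xp n_p; rewrite xc_n x_n addn1.
rewrite (sum_overflow_cons x_gt0 occ_xp) //; congr (_ + _).
(* Spot 0 counts as free because all entries are positive; it delimits a block that starts at spot
   1. *)
have ex_free_below : exists q, (q < x) && ~~ occupied c q.
  exists 0; rewrite x_gt0 freeE eqxx eqn0Ngt -has_count -all_predC.
  by apply: sub_all c_pos => y /=; lia.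
have ub q : (q < x) && ~~ occupied c q -> q <= x by lia.
case: (ex_maxnP ex_free_below ub) => q /andP[q_x q_free] q_max.
have occ_qp v : q < v < p -> occupied c v.
  move=> v_range; case: (ltnP v x) => v_x; last by apply: occ_xp; lia.
  apply/negPn/negP => v_free; have := q_max v; rewrite v_free andbT; lia.
have blockE s t : 0 < s <= x -> x <= t -> block c s t = [&& x < p, s == q.+1 & t == p.-1].
  move=> s_range x_t; apply/and3P/and3P => [[s_free /allP occ t_free]|[x_lt_p /eqP-> /eqP->]].
    have occ_st v : s <= v <= t -> occupied c v by move=> ?; apply: occ; rewrite mem_iota; lia.
    have x_lt_p : x < p.
      rewrite ltn_neqAle x_p andbT; apply: contra p_free => /eqP <-; apply: occ_st; lia.
    split=> //.
      have := q_max s.-1; rewrite s_free andbT.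
      suff: ~~ (s <= q) by lia.
      by apply: contra q_free => s_q; apply: occ_st; lia.
    have := p_min t.+1; rewrite t_free andbT.
    suff: ~~ (p <= t) by lia.
    by apply: contra p_free => p_t; apply: occ_st; lia.
  split=> //; last by rewrite prednK //; lia.
  by apply/allP => v; rewrite mem_iota => v_range; apply: occ_qp; lia.
under eq_big_nat => s s_range.
  under eq_big_nat => t t_range.
    rewrite blockE; [|lia|lia].
    over.
  over.
case: (ltnP x p) => x_lt_p; last first.
  rewrite big1 => [|s _]; first lia.
  by rewrite big1 // => t _; rewrite muln0.
rewrite (eq_bigr (fun s => if s == q.+1 then p - x else 0)) => [|s _]; last first.
  case: eqP => _ /=; last by rewrite big1 // => t _; rewrite muln0.
  rewrite (eq_bigr (fun t => if t == p.-1 then p - x else 0)) => [|t _]; last first.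
    by case: eqP => [->|]; lia.
  by rewrite -big_mkcond big_nat1_eq; have -> : x <= p.-1 < n by lia.
by rewrite -big_mkcond big_nat1_eq; have -> : 1 <= q.+1 < x.+1 by lia.
Qed.

(** When s-1 is free, no car enters the window s, ..., t from the left, so its spots see only the
    cars that prefer them. The three conditions concern disjoint classes of preferences, which is
    what lets the sum over [c] split. *)
Lemma blockE c s t : all (leq 1) c -> 0 < s <= t ->
  block c s t =
  [&& overflow (filter (fun x => x + 2 <= s) c) 0 (s - 2) == 0,
      Qind s t (t.+1 - s) (filter (fun x => s <= x <= t) c)
    & count (fun x => (x == s.-1) || (x == t.+1)) c == 0].
Proof.
move=> c_pos s_t.
have -> : count (fun x => (x == s.-1) || (x == t.+1)) c = count_mem s.-1 c + count_mem t.+1 c.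
  rewrite -count_predUI [X in _ + X](_ : _ = 0) ?addn0 //.
  by rewrite (eq_count (a2 := pred0)) ?count_pred0 // => x /=; lia.
rewrite overflow_filter; last by move=> v; lia.
rewrite /Qind filter_all overflow_filter /=; last by move=> v; lia.
rewrite size_filter addn_eq0 /block !freeE /=.
have -> : s.-2 = s - 2 by lia.
case: eqP => //= s0; case: eqP => /= [s1|_]; last by rewrite !andbF.
have s_0 : overflow c 0 s.-1 = 0.
  case: s s_t s0 s1 => // -[|s] //= _; rewrite subn2 /= => ->.
  by rewrite add0n => ->.
have shift := overflow_shift (t.+1 - s) s_0.
rewrite add0n in shift.
have e1 : s.-1 + (t.+1 - s) = t by lia.
rewrite -shift e1.
(* With no car entering at s and none leaving at t, the balance says that no spot is free iff
   exactly t+1-s cars prefer the window. *)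
have := overflow_balance c s.-1 (t.+1 - s); rewrite e1 s_0 prednK; last lia.
rewrite all_count -(count_predC (occupied c)) /predC /=.
move: (count (occupied c) _) (count (fun v => ~~ occupied c v) _) => o f.
move: (count _ c) (overflow c 0 t) (count_mem t.+1 c) => k v z.
lia.
Qed.

Section BlockSum.
Variables (b : seq nat) (s t : nat).
Hypothesis b_pos : all (leq 1) b.
Hypothesis s_t : 0 < s <= t.

Let p1 x := x + 2 <= s.
Let p2 x := s <= x <= t.
Let p3 x := t + 2 <= x.
Let p4 x := (x == s.-1) || (x == t.+1).

Lemma sum_split_block (A B C D : seq nat -> nat) (d : seq nat) :
  \sum_(c <- subs d)
     A (filter p1 c) * (B (filter p2 c) * (C (filter p3 c) * D (filter p4 c)))
  = (\sum_(c <- subs (filter p1 d)) A c) * ((\sum_(c <- subs (filter p2 d)) B c)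
    * ((\sum_(c <- subs (filter p3 d)) C c) * (\sum_(c <- subs (filter p4 d)) D c))).
Proof.
(* Each class is rewritten inside the complement of the preceding ones, so that the two-way split
   can be applied three times. *)
have f2 c : filter p2 c = filter p2 (filter (predC p1) c).
  by rewrite -filter_predI; apply: eq_filter => x /=; rewrite /p1 /p2; lia.
have f3 c : filter p3 c = filter p3 (filter (predC p2) (filter (predC p1) c)).
  by rewrite -!filter_predI; apply: eq_filter => x /=; rewrite /p1 /p2 /p3; lia.
have f4 c : filter p4 c
    = filter (predC p3) (filter (predC p2) (filter (predC p1) c)).
  by rewrite -!filter_predI; apply: eq_filter => x /=; rewrite /p1 /p2 /p3 /p4; lia.
under eq_bigr => c _ do rewrite f2 f3 f4.
rewrite (sum_subs_split p1 A (fun e => B (filter p2 e)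
  * (C (filter p3 (filter (predC p2) e)) * D (filter (predC p3) (filter (predC p2) e))))).
rewrite (sum_subs_split p2 B (fun e => C (filter p3 e) * D (filter (predC p3) e))).
by rewrite (sum_subs_split p3 C D) -f2 -f3 -f4.
Qed.

Lemma block_indicator c : all (leq 1) c ->
  block c s t = Qind 1 (s - 2) (size (filter p1 c)) (filter p1 c)
    && (Qind s t (t.+1 - s) (filter p2 c) && (size (filter p4 c) == 0)) :> bool.
Proof.
move=> c_pos; rewrite blockE // (size_filter p4); congr (_ && _).
rewrite /Qind eqxx subn1 /=; case: (boolP (all _ _)) => //=; last first.
  rewrite all_filter; move/negP; case; apply: sub_all c_pos => x; rewrite /p1 /=; lia.
Qed.

(** For given l and g the weight is constant, since the block holds exactly t+1-s entries and nobody
    prefers s-1 or t+1. The cars beyond t+1 are subject to no condition but their number, hence the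
    binomial coefficient. *)
Lemma sum_block_weight (w : nat -> nat) :
  \sum_(c <- subs b) w (size c) * block c s t
  = Q b s t (t.+1 - s)
    * \sum_(0 <= l < (Lam t b).+1) \sum_(0 <= g < (Gam s b).+1)
        'C(Lam t b, l) * Q b 1 (s - 2) g * w (t.+1 - s + l + g).
Proof.
pose ind l g c := Qind 1 (s - 2) g (filter p1 c) * (Qind s t (t.+1 - s) (filter p2 c)
  * ((size (filter p3 c) == l) * (size (filter p4 c) == 0))).
have sum_ind l g : \sum_(c <- subs b) ind l g c
    = Q b 1 (s - 2) g * (Q b s t (t.+1 - s) * 'C(Lam t b, l)).
  rewrite /ind (sum_split_block (fun c => Qind 1 (s - 2) g c)
    (fun c => Qind s t (t.+1 - s) c) (fun c => size c == l) (fun c => size c == 0)).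
  rewrite sum_subs_nil sum_subs_size size_filter muln1; congr (_ * (_ * _)).
    rewrite Q_subs //.
    have -> : filter p1 b = filter (fun x => 1 <= x <= s - 2) b.
      by apply: eq_in_filter => x /(allP b_pos); rewrite /p1; lia.
    rewrite (@sum_subs_filter _ _ (fun c => Qind 1 (s - 2) g c)) // => c.
    by rewrite /Qind => /negPf ->; rewrite andbF.
  rewrite Q_subs; last lia.
  rewrite (@sum_subs_filter _ _ (fun c => Qind s t (t.+1 - s) c)) // => c.
  by rewrite /Qind => /negPf ->; rewrite andbF.
rewrite big_distrr /=.
transitivity (\sum_(0 <= l < (Lam t b).+1) \sum_(0 <= g < (Gam s b).+1)
    \sum_(c <- subs b) w (t.+1 - s + l + g) * ind l g c); last first.
  apply: eq_bigr => l _; rewrite big_distrr /=; apply: eq_bigr => g _.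
  rewrite -big_distrr /= sum_ind.
  move: (Q b s t _) ('C(_, _)) (Q b 1 _ _) (w _) => q1 q2 q3 q4; lia.
under [RHS]eq_bigr => l _ do rewrite exchange_big /=.
rewrite exchange_big /=; apply: eq_big_seq => c c_b.
have c_pos := all_subs b_pos c_b.
have sub_c := mem_subs c_b.
(* A given [c] can contribute only to the pair (l, g) of its own sizes, so the double sum over l and
   g collapses. *)
pose l0 := size (filter p3 c); pose g0 := size (filter p1 c).
have l0_le : l0 <= Lam t b by rewrite /l0 size_filter leq_count_subseq.
have g0_le : g0 <= Gam s b by rewrite /g0 size_filter leq_count_subseq.
rewrite (eq_bigr (fun l => if l == l0 then w (t.+1 - s + l0 + g0) * ind l0 g0 c else 0)); last first.
  move=> l _; case: eqP => [->|l_l0]; last first.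
    rewrite big1 // => g _; rewrite /ind.
    by rewrite [_ == l](negbTE _) ?mul0n ?muln0 //; apply/eqP => e; apply: l_l0.
  rewrite (eq_bigr (fun g => if g == g0 then w (t.+1 - s + l0 + g0) * ind l0 g0 c else 0)).
    by rewrite -big_mkcond big_nat1_eq ltnS g0_le.
  move=> g _; case: eqP => [->//|g_g0].
  rewrite /ind /Qind [_ == g](negbTE _) ?mul0n ?muln0 //; apply/eqP => e.
  by apply: g_g0.
rewrite -big_mkcond big_nat1_eq ltnS l0_le /= block_indicator // /ind eqxx mul1n !mulnb.
case: (boolP (_ && _)) => [/andP[q1 /andP[q2 /eqP q4]]|]; last by rewrite !muln0.
congr (w _ * _).
have -> : size c = size (filter p2 c) + l0 + g0 + size (filter p4 c).
  rewrite /l0 /g0 !size_filter; elim: (c) => //= x d ->.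
  rewrite /p1 /p2 /p3 /p4; lia.
by case/and3P: q2 => /eqP -> _ _; rewrite q4 addn0.
Qed.
End BlockSum.

(* The number of permutations of n elements in which the predecessors of a given one
   form a given set of k elements. *)
Definition num_orders n k := k`! * (n.-1 - k)`!.

Lemma sum_block_formula n b s t : all (leq 1) b -> 0 < s <= t -> 0 < n ->
  \sum_(c <- subs b) num_orders n (size c) * block c s t
  = Q b s t (t.+1 - s) * Rsum n b s t.
Proof.
move=> b_pos s_t n_gt0; rewrite sum_block_weight //; congr (_ * _).
apply: eq_bigr => l _; apply: eq_bigr => g _.
rewrite /num_orders mulnA; congr (_ * _`!); lia.
Qed.

Definition total_overflow (n : nat) (c : seq nat) := \sum_(v < n) overflow c 0 v.

Lemma sum_marginal n b x : all (leq 1) b -> 0 < x <= n -> overflow (x :: b) 0 n = 0 ->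
  \sum_(c <- subs b) num_orders n (size c) * (total_overflow n (x :: c) - total_overflow n c)
  = \sum_(1 <= s < x.+1) \sum_(x <= t < n)
      (t - x + 1) * Q b s t (t.+1 - s) * Rsum n b s t.
Proof.
move=> b_pos x_range xb_n.
transitivity (\sum_(c <- subs b) \sum_(1 <= s < x.+1) \sum_(x <= t < n)
    (t - x + 1) * (num_orders n (size c) * block c s t)).
  apply: eq_big_seq => c c_b; rewrite {1}/total_overflow sum_block; [|exact: all_subs c_b|lia| |lia].
    rewrite addKn big_distrr /=; apply: eq_bigr => s _.
    by rewrite big_distrr /=; apply: eq_bigr => t _; rewrite mulnCA.
  apply/eqP; rewrite -leqn0 -[X in _ <= X]xb_n; apply: overflow_leq => v /=.
  by rewrite leq_add2l leq_count_subseq // mem_subs.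
rewrite exchange_big /=; apply: eq_big_nat => s s_range.
rewrite exchange_big /=; apply: eq_big_nat => t t_range.
rewrite -big_distrr /= sum_block_formula ?mulnA //; lia.
Qed.

(** * Permutations with a prescribed set of predecessors *)

Lemma card_perm_lt n (pi : 'S_n) (j : 'I_n) : #|[set i | pi i < pi j]| = pi j.
Proof.
rewrite -(card_imset _ (@perm_inj _ pi)).
transitivity #|[set v : 'I_n | v < pi j]|.
  apply: eq_card => v; rewrite inE; apply/imsetP/idP => [[i]|v_lt].
    by rewrite inE => i_j ->.
  by exists (pi^-1%g v); rewrite ?inE permKV.
rewrite -sum1_card (eq_bigl (fun v : 'I_n => v < pi j)) => [|v]; last by rewrite inE.
by rewrite -(big_ord_widen n (fun=> 1)) ?sum1_card ?card_ord // ltnW.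
Qed.

(** Such a permutation is a product of one of [S] and one of the complement of [j |: S]. The two
    symmetric groups meet trivially, so their orders multiply. *)
Lemma card_Sym_stab (T : finType) (S : {set T}) (j : T) : j \notin S ->
  #|[set sigma : {perm T} | (sigma j == j) && [forall i, (sigma i \in S) == (i \in S)]]|
  = #|S|`! * (#|T|.-1 - #|S|)`!.
Proof.
move=> j_S; pose U := ~: (j |: S).
have card_U : #|U| = #|T|.-1 - #|S|.
  by have := cardsC (j |: S); rewrite -/U cardsU1 j_S; lia.
rewrite -card_U -!card_Sym.
rewrite -TI_cardMg; last first.
  apply/trivgP/subsetP => s; rewrite !inE => /andP[onS onU]; apply/eqP/permP => x.
  rewrite perm1; case: (boolP (x \in S)) => xS; last exact: out_perm onS xS.
  by apply: (out_perm onU); rewrite !inE xS orbT.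
apply: eq_card => s; rewrite inE; apply/andP/mulsgP => [[/eqP sj /forallP stab]|].
  have sN : s \in 'N(S | 'P)%g.
    apply/astabsP => x; rewrite /= apermE; exact/eqP/stab.
  have onS := restr_perm_on S s.
  exists (restr_perm S s) ((restr_perm S s)^-1 * s)%g; rewrite ?inE ?mulKVg //.
  apply/subsetP => x; rewrite inE permM; apply: contraR.
  rewrite !inE negbK => /orP[/eqP->|xS].
    by rewrite (out_perm (perm_onV onS)) ?sj.
  have xS' : (restr_perm S s)^-1%g x \in S by rewrite (perm_closed _ (perm_onV onS)).
  by rewrite -(restr_permE sN xS') permKV.
case=> u v; rewrite !inE => onS onU ->; split.
  by rewrite permM (out_perm onS) // (out_perm onU) // !inE eqxx.
apply/forallP => i; rewrite permM; apply/eqP.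
rewrite -(perm_closed i onS); move: (u i) => x.
case: (boolP (x \in U)) => xU; last by rewrite (out_perm onU).
have: v x \in U by rewrite (perm_closed _ onU).
by move: xU; rewrite !inE !negb_or => /andP[_ /negPf->] /andP[_ /negPf->].
Qed.

Definition before n (pi : 'S_n) (j : 'I_n) : {set 'I_n} := [set i | pi i < pi j].

(** List [S], then [j], then the rest, and send each element to its index. *)
Lemma before_exists n (j : 'I_n) (S : {set 'I_n}) : j \notin S -> exists pi, before pi j = S.
Proof.
move=> j_S; pose e := enum S ++ j :: enum (~: (j |: S)).
have e_all i : i \in e.
  by rewrite mem_cat inE !mem_enum !inE; case: (i \in S); case: (i == j).
have e_uniq : uniq e.
  rewrite cat_uniq cons_uniq !enum_uniq !mem_enum !inE eqxx /= andbT.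
  rewrite mem_enum negb_or j_S; apply/hasPn => i /=.
  by rewrite !mem_enum !inE negb_or => /andP[].
have size_e : size e = n.
  by rewrite -[RHS]card_ord -(card_uniqP e_uniq); apply: eq_card => i; rewrite e_all.
have lt_e i : index i e < n by rewrite -[X in _ < X]size_e index_mem.
have inj : injective (fun i => Ordinal (lt_e i)).
  by move=> i i' [e_ii']; rewrite -(nth_index j (e_all i)) e_ii' nth_index.
exists (perm inj); apply/setP => i; rewrite inE !permE /= !index_cat !mem_enum (negPf j_S).
rewrite /= eqxx addn0; case: ifP => iS; last by apply/negbTE; rewrite -leqNgt leq_addr.
by rewrite index_mem mem_enum.
Qed.

(** These permutations form a coset: [pi j] is forced to be the cardinality of [S], so any two of
    them differ by a permutation that fixes [j] and preserves [S]. *)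
Lemma card_before n (j : 'I_n) (S : {set 'I_n}) : j \notin S ->
  #|[set pi : 'S_n | before pi j == S]| = num_orders n #|S|.
Proof.
move=> j_S; have [pi0 pi0S] := before_exists j_S.
have val_j pi : before pi j = S -> pi j = pi0 j.
  move=> piS; apply: val_inj.
  by rewrite /= -(card_perm_lt pi) -(card_perm_lt pi0) -/(before pi j) piS -pi0S.
have := card_Sym_stab j_S; rewrite card_ord -/(num_orders n #|S|) => <-.
rewrite -[RHS](card_imset _ (mulIg pi0)); apply: eq_card => pi; rewrite inE.
apply/eqP/imsetP => [piS|[s]].
  exists (pi * pi0^-1)%g; last by rewrite mulgKV.
  rewrite inE permM (val_j _ piS) permK eqxx; apply/forallP => i; apply/eqP.
  rewrite permM -[in LHS]pi0S -piS !inE permKV.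
  by rewrite -(val_j _ piS).
rewrite inE => /andP[/eqP sj /forallP stab] ->; apply/setP => i.
by rewrite inE !permM sj -(eqP (stab i)) -[in RHS]pi0S inE.
Qed.

Lemma sum_before n (f : {set 'I_n} -> nat) (j : 'I_n) :
  \sum_(pi : 'S_n) f (before pi j) = \sum_(S : {set 'I_n} | j \notin S) num_orders n #|S| * f S.
Proof.
rewrite (partition_big (fun pi : 'S_n => before pi j) (fun S => j \notin S)) /=; last first.
  by move=> pi _; rewrite inE ltnn.
apply: eq_bigr => S j_S; rewrite -(card_before j_S).
rewrite (eq_bigr (fun _ : 'S_n => f S)) => [|pi /eqP-> //].
by rewrite sum_nat_const cardsE.
Qed.

Lemma subtuple_subseq n (a : n.-tuple nat) (S : {set 'I_n}) : subseq (subtuple a S) a.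
Proof.
have {2}-> : a = [seq nth 0 a (val i) | i <- enum 'I_n] :> seq nat.
  by rewrite map_comp val_enum_ord map_nth_iota0 ?size_tuple // take_oversize ?size_tuple.
by apply: map_subseq; rewrite enumT; apply: filter_subseq.
Qed.

Lemma perm_total_overflow n c d : perm_eq c d -> total_overflow n c = total_overflow n d.
Proof. by move=> cd; apply: eq_bigr => v _; apply: perm_overflow. Qed.

Lemma PF_subseq n b c : PF n n b -> subseq c b -> PF (size c) n c.
Proof.
rewrite !PF_E => /and3P[_ /allP b_n /eqP b0] cb; rewrite eqxx /=; apply/andP; split.
  by apply/allP => x /(mem_subseq cb)/b_n.
rewrite -leqn0 -[X in _ <= X]b0; apply: overflow_leq => v.
exact: leq_count_subseq.
Qed.

Lemma game_costE n (a : n.-tuple nat) (S : {set 'I_n}) :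
  PF n n a -> game_cost a S = total_overflow n (subtuple a S).
Proof. by move=> aPF; apply: displacementE (PF_subseq aPF (subtuple_subseq a S)). Qed.

Lemma subtupleU1 n (a : n.-tuple nat) (S : {set 'I_n}) j : j \notin S ->
  perm_eq (subtuple a (j |: S)) (tnth a j :: subtuple a S).
Proof.
move=> j_S; rewrite (tnth_nth 0) -[_ :: _]/(map (fun i : 'I_n => nth 0 a i) (j :: enum S)).
apply: perm_map; apply: uniq_perm; rewrite /= ?enum_uniq ?mem_enum ?j_S //.
by move=> i; rewrite inE !mem_enum !inE.
Qed.

Lemma subtupleT n (a : n.-tuple nat) : subtuple a [set: 'I_n] = a.
Proof.
rewrite /subtuple (eq_enum (B := 'I_n)) => [|i]; last by rewrite inE.
by rewrite map_comp val_enum_ord map_nth_iota0 ?size_tuple // take_oversize ?size_tuple.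
Qed.

Lemma perm_remove_at b i : i < size b -> perm_eq (nth 0 b i :: remove_at b i) b.
Proof.
move=> i_b; have e : take i b ++ nth 0 b i :: drop i.+1 b = b.
  by rewrite -drop_nth // cat_take_drop.
rewrite -[X in perm_eq _ X]e perm_sym -cat_rcons /remove_at -cat_cons.
by rewrite perm_cat2r perm_rcons.
Qed.

Lemma total_overflow_cons n x c : total_overflow n c <= total_overflow n (x :: c).
Proof. by apply: leq_sum => v _; apply: overflow_leq => u /=; apply: leq_addl. Qed.

(** Sets avoiding [j] are the subsets of the other cars, whose preferences form, up to order, the
    sorted tuple without its entry at position [r j]. *)
Lemma sum_before_formula n (a : n.-tuple nat) (r : {perm 'I_n}) j :
  PF n n a -> is_rank a r ->
  \sum_(pi : 'S_n) (game_cost a (j |: before pi j) - game_cost a (before pi j))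
  = formula_sum n (rearrangement a) (r j).
Proof.
move=> aPF r_rank; set x := tnth a j; pose b := subtuple a [set~ j].
have xb_a : perm_eq (x :: b) a.
  rewrite perm_sym -[X in perm_eq X](subtupleT a) -(setUCr [set j]) subtupleU1 //.
  by rewrite !inE eqxx.
rewrite (sum_before (fun S => game_cost a (j |: S) - game_cost a S)).
pose F c := num_orders n (size c) * (total_overflow n (x :: c) - total_overflow n c).
have F_inv : perm_invariant F.
  move=> c d cd; rewrite /F (perm_size cd) (perm_total_overflow _ cd).
  by rewrite (@perm_total_overflow _ (x :: c) (x :: d)) // perm_cons.
transitivity (\sum_(c <- subs b) F c).
  rewrite -sum_subsets ?enum_uniq //; apply: eq_big => [S|S j_S].
    apply/idP/subsetP => [j_S i iS|sub].
      by rewrite mem_enum !inE; apply: contra j_S => /eqP <-.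
    by apply/negP => /sub; rewrite mem_enum !inE eqxx.
  rewrite /F !game_costE // (perm_total_overflow _ (subtupleU1 _ j_S)).
  by rewrite size_map -cardE.
have n_gt0 : 0 < n by case: (n) j {r r_rank x b aPF xb_a F F_inv a} => [[]|].
set a' := rearrangement a.
have a'_a : perm_eq a' a by rewrite perm_sort.
have size_a' : size a' = n by rewrite (perm_size a'_a) size_tuple.
have x_nth : x = nth 0 a' (r j) by exact: r_rank.
have b_rem : perm_eq b (remove_at a' (r j)).
  rewrite -(perm_cons x) {2}x_nth (perm_trans xb_a) // perm_sym.
  by rewrite (perm_trans (perm_remove_at _)) ?size_a'.
have := aPF; rewrite PF_E => /and3P[_ /allP a_n /eqP a0].
have a'_pos : all (leq 1) (remove_at a' (r j)).
  apply/allP => y; rewrite -(perm_mem b_rem) => y_b.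
  by have := a_n y; rewrite -(perm_mem xb_a) inE y_b orbT => /(_ isT)/andP[].
rewrite (perm_sum_subs F_inv b_rem) sum_marginal //.
- by rewrite /formula_sum -x_nth.
- by apply: a_n; rewrite mem_tnth.
rewrite -[RHS]a0; apply: perm_overflow; apply: perm_trans xb_a.
by rewrite perm_cons perm_sym.
Qed.

Lemma shapley_formula n (a : n.-tuple nat) (r : {perm 'I_n}) (R : realType) j :
  PF n n a -> is_rank a r ->
  shapley (fun S : {set 'I_n} => (game_cost a S)%:R%R : R) j
  = ((n`!)%:R^-1 * (formula_sum n (rearrangement a) (r j))%:R)%R.
Proof.
move=> aPF r_rank; rewrite /shapley -(sum_before_formula j aPF r_rank) natr_sum.
congr (_ * _)%R; apply: eq_bigr => pi _; rewrite -/(before pi j).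
have -> : [set i | pi i <= pi j] = j |: before pi j.
  by apply/setP => i; rewrite !inE leq_eqVlt (inj_eq val_inj) (inj_eq perm_inj).
rewrite natrB // !game_costE // (perm_total_overflow _ (subtupleU1 _ _)) ?total_overflow_cons //.
by rewrite inE ltnn.
Qed.

Lemma rank_exists n (a : n.-tuple nat) : exists r : {perm 'I_n}, is_rank a r.
Proof.
have : perm_eq a (sort_tuple leq a) by rewrite perm_sym perm_sort.
case/tuple_permP => r /= a_r; exists r => j.
rewrite (tnth_nth 0) [X in nth 0 X j]a_r (nth_map j) ?size_enum_ord // nth_ord_enum (tnth_nth 0).
by [].
Qed.

(** * Cost-bounded evaluation *)

Lemma bindc_Some (A B : Type) (x : option (A * nat)) (f : A -> option (B * nat)) b c :
  bindc x f = Some (b, c) ->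
  exists a c1 c2, [/\ x = Some (a, c1), f a = Some (b, c2) & c = c1 + c2].
Proof.
case: x => [[a c1]|] //=; case fa: (f a) => [[b' c2]|] // [<- <-].
by exists a, c1, c2.
Qed.

(** A named copy of the anonymous fixpoint in [eval], so that inductions on argument lists can be
    stated. *)
Definition eval_args (ev : expr -> option (value * nat)) :=
  fix evs (es : seq expr) : option (seq value * nat) :=
    if es is e1 :: es' then
      bindc (ev e1) (fun v => bindc (evs es') (fun vs => Some (v :: vs, 0)))
    else Some ([::], 0).

Lemma eval_args_mono ev ev' es r :
  (forall e s, ev e = Some s -> ev' e = Some s) ->
  eval_args ev es = Some r -> eval_args ev' es = Some r.
Proof.
move=> mono; elim: es r => [//|e es IHes] [vs c] /= eq_r.
have [v [c1 [c2 [/mono-> eq_vs ->]]]] := bindc_Some eq_r.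
have [vs' [c3 [c4 [eq_es [<- <-] ->]]]] := bindc_Some eq_vs.
by rewrite (IHes _ eq_es) /= !addn0.
Qed.

(** Subterms come with different amounts of fuel; monotonicity lets the evaluation rules take the
    maximum. *)
Lemma evalS fuel p env e r :
  eval fuel p env e = Some r -> eval fuel.+1 p env e = Some r.
Proof.
elim: fuel env e r => // fuel IH env e [v c] eq_r.
have [[] [c1 [c2 [[<-] eq_v ->]]]] := bindc_Some eq_r.
transitivity (tick (Some (v, c2))) => //.
rewrite /=; congr tick.
case: e eq_v {eq_r} => [x|n||o e|o e1 e2|x e1 e2|e1 e2 e3|f es] // eq_v.
- by have [w [c3 [c4 [/IH /= -> /= ->  ->]]]] := bindc_Some eq_v.
- have [w [c3 [c4 [/IH /= -> eq_w ->]]]] := bindc_Some eq_v.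
  by have [w' [c5 [c6 [/IH /= -> /= ->  ->]]]] := bindc_Some eq_w.
- by have [w [c3 [c4 [/IH /= -> /IH /= ->  ->]]]] := bindc_Some eq_v.
- have [w [c3 [c4 [/IH /= ->]]]] := bindc_Some eq_v; case: w => // b.
  by move=> /IH /= -> ->.
- have [vs [c3 [c4 [eq_es eq_f ->]]]] := bindc_Some eq_v.
  have /= := eval_args_mono (IH env) eq_es.
  rewrite -/(eval_args _ es) => -> /=.
  move: eq_f; case: find_fun => // -[[? params] body]; case: eqP => // _.
  by move=> /IH /= ->.
Qed.

Lemma eval_fuel_mono fuel fuel' p env e r :
  fuel <= fuel' -> eval fuel p env e = Some r -> eval fuel' p env e = Some r.
Proof.
move=> /subnK <-; elim: (fuel' - fuel) => // k IH /IH.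
by rewrite addSn; apply: evalS.
Qed.

Lemma eval_args_fuel_mono fuel fuel' p env es r :
  fuel <= fuel' -> eval_args (eval fuel p env) es = Some r ->
  eval_args (eval fuel' p env) es = Some r.
Proof. by move=> le_fuel; apply: eval_args_mono => e s; apply: eval_fuel_mono. Qed.

(* In [ev], [evs] and [evf], [C] is an upper bound for the cost. *)
Definition ev env e v C := exists fuel c,
  eval fuel shapley_program env e = Some (v, c) /\ c <= C.

Definition evs env es vs C := exists fuel c,
  eval_args (eval fuel shapley_program env) es = Some (vs, c) /\ c <= C.

Definition evf f args v C := exists params body,
  [/\ find_fun shapley_program f = Some (f, params, body),
      size params = size args & ev (zip params args) body v C].

Lemma ev_le env e v C C' : ev env e v C -> C <= C' -> ev env e v C'.
Proof.
move=> [fuel [c [eq_v c_C]]] C_C'; exists fuel, c; split=> //.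
exact: leq_trans C_C'.
Qed.

Lemma evf_le f args v C C' : evf f args v C -> C <= C' -> evf f args v C'.
Proof.
move=> [ps [body [eq_f size_ps /ev_le le_ev]]] C_C'; exists ps, body; split=> //.
exact: le_ev.
Qed.

Lemma evf_intro f args v w C C' params body :
  find_fun shapley_program f = Some (f, params, body) -> size params = size args ->
  ev (zip params args) body v C -> v = w -> C <= C' -> evf f args w C'.
Proof. by move=> eq_f size_ps ev_b <- C_C'; apply: evf_le C_C'; exists params, body. Qed.

Lemma evf_args f args args' v C : args = args' -> evf f args' v C -> evf f args v C.
Proof. by move=> ->. Qed.

Lemma ev_var env x v : lookup env x = Some v -> ev env (Var x) v 1.
Proof. by move=> eq_v; exists 1, 1; rewrite /= eq_v. Qed.

Lemma ev_num env n : ev env (Defs.Num n) (VNum n) 1.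
Proof. by exists 1, 1. Qed.

Lemma ev_null env : ev env Null VNil 1.
Proof. by exists 1, 1. Qed.

Lemma ev_op1 env o e v w C :
  ev env e v C -> eval1 o v = Some (w, 0) -> ev env (Op1 o e) w C.+1.
Proof.
move=> [fuel [c [eq_v c_C]]] eq_w; exists fuel.+1, c.+1; split=> //.
by rewrite /= eq_v /= eq_w /= addn0.
Qed.

Lemma ev_op2 env o e1 e2 v1 v2 w C1 C2 d :
  ev env e1 v1 C1 -> ev env e2 v2 C2 -> eval2 o v1 v2 = Some (w, d) ->
  ev env (Op2 o e1 e2) w (C1 + C2 + d).+1.
Proof.
move=> [f1 [c1 [eq1 le1]]] [f2 [c2 [eq2 le2]]] eq_w.
exists (maxn f1 f2).+1, (c1 + (c2 + d)).+1; split; last lia.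
rewrite /= (eval_fuel_mono (leq_maxl _ _) eq1) /=.
by rewrite (eval_fuel_mono (leq_maxr _ _) eq2) /= eq_w.
Qed.

Lemma ev_let env x e1 e2 v w C1 C2 :
  ev env e1 v C1 -> ev ((x, v) :: env) e2 w C2 -> ev env (Let x e1 e2) w (C1 + C2).+1.
Proof.
move=> [f1 [c1 [eq1 le1]]] [f2 [c2 [eq2 le2]]].
exists (maxn f1 f2).+1, (c1 + c2).+1; split; last lia.
rewrite /= (eval_fuel_mono (leq_maxl _ _) eq1) /=.
by rewrite (eval_fuel_mono (leq_maxr _ _) eq2).
Qed.

Lemma ev_if_true env e1 e2 e3 n v C1 C2 :
  ev env e1 (VNum n.+1) C1 -> ev env e2 v C2 -> ev env (If e1 e2 e3) v (C1 + C2).+1.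
Proof.
move=> [f1 [c1 [eq1 le1]]] [f2 [c2 [eq2 le2]]].
exists (maxn f1 f2).+1, (c1 + c2).+1; split; last lia.
rewrite /= (eval_fuel_mono (leq_maxl _ _) eq1) /=.
by rewrite (eval_fuel_mono (leq_maxr _ _) eq2).
Qed.

Lemma ev_if_false env e1 e2 e3 v C1 C2 :
  ev env e1 (VNum 0) C1 -> ev env e3 v C2 -> ev env (If e1 e2 e3) v (C1 + C2).+1.
Proof.
move=> [f1 [c1 [eq1 le1]]] [f2 [c2 [eq2 le2]]].
exists (maxn f1 f2).+1, (c1 + c2).+1; split; last lia.
rewrite /= (eval_fuel_mono (leq_maxl _ _) eq1) /=.
by rewrite (eval_fuel_mono (leq_maxr _ _) eq2).
Qed.

(** For conditions whose truth is known from a hypothesis and not by computation. *)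
Lemma ev_if_holds env e1 e2 e3 (b : bool) v C1 C2 :
  ev env e1 (VNum b) C1 -> b -> ev env e2 v C2 -> ev env (If e1 e2 e3) v (C1 + C2).+1.
Proof. by case: b => // ev1 _; apply: (@ev_if_true _ _ _ _ 0). Qed.

Lemma ev_if_fails env e1 e2 e3 (b : bool) v C1 C2 :
  ev env e1 (VNum b) C1 -> ~~ b -> ev env e3 v C2 -> ev env (If e1 e2 e3) v (C1 + C2).+1.
Proof. by case: b => // ev1 _; apply: ev_if_false. Qed.

Lemma ev_if env e1 e2 e3 (b : bool) v2 v3 C1 C2 C3 :
  ev env e1 (VNum b) C1 -> (b -> ev env e2 v2 C2) -> (~~ b -> ev env e3 v3 C3) ->
  ev env (If e1 e2 e3) (if b then v2 else v3) (C1 + maxn C2 C3).+1.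
Proof.
case: b => ev1 ev2 ev3.
  by apply: ev_le (ev_if_true _ ev1 (ev2 _)) _ => //; lia.
by apply: ev_le (ev_if_false _ ev1 (ev3 _)) _ => //; lia.
Qed.

Lemma ev_if_num env e1 e2 e3 (b : bool) n2 n3 C1 C2 C3 :
  ev env e1 (VNum b) C1 -> (b -> ev env e2 (VNum n2) C2) ->
  (~~ b -> ev env e3 (VNum n3) C3) ->
  ev env (If e1 e2 e3) (VNum (if b then n2 else n3)) (C1 + maxn C2 C3).+1.
Proof. by move=> ev1 ev2 ev3; rewrite (fun_if VNum); apply: ev_if. Qed.

Lemma ev_and env e1 e2 (b1 b2 : bool) C1 C2 :
  ev env e1 (VNum b1) C1 -> (b1 -> ev env e2 (VNum b2) C2) ->
  ev env (If e1 e2 (Defs.Num 0)) (VNum (b1 && b2)) (C1 + C2 + 2).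
Proof.
move=> ev1 ev2; apply: ev_le (_ : ev _ _ _ (C1 + maxn C2 1).+1) _; last lia.
case: b1 ev1 ev2 => ev1 ev2; first exact: (ev_if ev1 ev2 (fun _ => ev_num env 0)).
exact: (ev_if ev1 (fun b => ev2 b) (fun _ => ev_num env 0)).
Qed.

Lemma ev_or env e1 e2 (b1 b2 : bool) C1 C2 :
  ev env e1 (VNum b1) C1 -> (~~ b1 -> ev env e2 (VNum b2) C2) ->
  ev env (If e1 (Defs.Num 1) e2) (VNum (b1 || b2)) (C1 + C2 + 2).
Proof.
move=> ev1 ev2; apply: ev_le (_ : ev _ _ _ (C1 + maxn 1 C2).+1) _; last lia.
case: b1 ev1 ev2 => ev1 ev2; first exact: (ev_if ev1 (fun _ => ev_num env 1) (fun b => ev2 b)).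
exact: (ev_if ev1 (fun _ => ev_num env 1) ev2).
Qed.

Lemma evs_nil env : evs env [::] [::] 0.
Proof. by exists 0, 0. Qed.

Lemma evs_cons env e es v vs C1 C2 :
  ev env e v C1 -> evs env es vs C2 -> evs env (e :: es) (v :: vs) (C1 + C2).
Proof.
move=> [f1 [c1 [eq1 le1]]] [f2 [c2 [eq2 le2]]].
exists (maxn f1 f2), (c1 + c2); split; last lia.
rewrite /= (eval_fuel_mono (leq_maxl _ _) eq1) /=.
by rewrite (eval_args_fuel_mono (leq_maxr _ _) eq2) /= addn0.
Qed.

Lemma ev_call env f es vs v C1 C2 :
  evs env es vs C1 -> evf f vs v C2 -> ev env (Call f es) v (C1 + C2).+1.
Proof.
move=> [f1 [c1 [eq1 le1]]] [params [body [eq_f size_ps [f2 [c2 [eq2 le2]]]]]].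
exists (maxn f1 f2).+1, (c1 + c2).+1; split; last lia.
rewrite /= -/(eval_args _ es) (eval_args_fuel_mono (leq_maxl _ _) eq1) /=.
by rewrite eq_f size_ps eqxx (eval_fuel_mono (leq_maxr _ _) eq2).
Qed.

Lemma bits_leS n : bits n <= n.+1.
Proof.
rewrite /bits ltnS; case: n => [|n]; first by rewrite trunc_log0.
exact: leq_trans (ltnW (ltn_expl _ (ltnSn 1))) (trunc_logP (ltnSn 1) (ltn0Sn n)).
Qed.

(** Bit lengths are replaced by the numbers themselves. This is affordable for lengths, entries and
    indices, and keeps the costs of additions and comparisons linear, within reach of [lia]. *)
Lemma ev_small env o e1 e2 m n w C1 C2 :
  ev env e1 (VNum m) C1 -> ev env e2 (VNum n) C2 ->
  eval2 o (VNum m) (VNum n) = Some (w, bits m + bits n) ->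
  ev env (Op2 o e1 e2) w (C1 + C2 + m + n + 3).
Proof.
move=> ev1 ev2 eq_w; apply: ev_le (ev_op2 ev1 ev2 eq_w) _.
have := (bits_leS m, bits_leS n) => -[]; lia.
Qed.

Lemma ev_cons env e1 e2 v w C1 C2 :
  ev env e1 v C1 -> ev env e2 w C2 -> ev env (Op2 Defs.Cons e1 e2) (VCons v w) (C1 + C2).+1.
Proof.
move=> ev1 ev2; apply: ev_le (@ev_op2 _ Defs.Cons _ _ _ _ (VCons v w) _ _ 0 ev1 ev2 (erefl _)) _; lia.
Qed.

Lemma lookup_head x v env : lookup ((x, v) :: env) x = Some v.
Proof. by rewrite /lookup /= String.eqb_refl. Qed.

Lemma lookup_tail x y v w env :
  String.eqb x y = false -> lookup env x = Some v -> lookup ((y, w) :: env) x = Some v.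
Proof. by rewrite /lookup /= => ->. Qed.

Ltac lookup_auto :=
  first [exact: lookup_head | apply: lookup_tail; [reflexivity | lookup_auto]].

(* [arith] handles an arithmetic operation, [call] the call of a function. *)
Ltac ev_auto arith call :=
  lazymatch goal with
  | |- ev _ (Var _) _ _ => apply: ev_var; lookup_auto
  | |- ev _ (Defs.Num _) _ _ => exact: ev_num
  | |- ev _ Null _ _ => exact: ev_null
  | |- ev _ (Op1 _ _) _ _ => eapply ev_op1; [ev_auto arith call | reflexivity]
  | |- ev _ (Op2 Defs.Cons _ _) _ _ => eapply ev_cons; [ev_auto arith call | ev_auto arith call]
  | |- ev _ (Op2 _ _ _) _ _ => arith ltac:(idtac; ev_auto arith call)
  | |- ev _ (Let _ _ _) _ _ => eapply ev_let; [ev_auto arith call | ev_auto arith call]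
  | |- ev _ (Call _ _) _ _ => eapply ev_call; [evs_auto arith call | call]
  | |- ev _ (If _ _ _) _ _ =>
    (* The order matters: conditions that compute to a literal, then the encodings of conjunction
       and disjunction, then branches that are both numbers, and last the general rule. The numeric
       rule keeps a result of the form [VNum _], as an enclosing operation requires. *)
    first [ eapply ev_if_true; [solve [ev_auto arith call] | ev_auto arith call]
          | eapply ev_if_false; [solve [ev_auto arith call] | ev_auto arith call]
          | eapply ev_and; [solve [ev_auto arith call]
                           | let H := fresh "cond" in intro H; ev_auto arith call]
          | eapply ev_or; [solve [ev_auto arith call]
                          | let H := fresh "cond" in intro H; ev_auto arith call]
          | eapply ev_if_num; [ev_auto arith call | let H := fresh "cond" in intro H; ev_auto arith call
                                            | let H := fresh "cond" in intro H; ev_auto arith call]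
          | eapply ev_if; [ev_auto arith call | let H := fresh "cond" in intro H; ev_auto arith call
                                        | let H := fresh "cond" in intro H; ev_auto arith call] ]
  end
with evs_auto arith call :=
  lazymatch goal with
  | |- evs _ [::] _ _ => exact: evs_nil
  | |- evs _ (_ :: _) _ _ => eapply evs_cons; [ev_auto arith call | evs_auto arith call]
  end.

Ltac arith_small rec := eapply ev_small; [rec | rec | reflexivity].

Ltac evf_auto call :=
  eapply evf_intro; [reflexivity | reflexivity | cbn [zip]; ev_auto arith_small call | | ].

(** * The list functions of the program *)

Section ListFunctions.
Local Open Scope string_scope.
Local Open Scope nat_scope.
Variable N : nat.
Hypothesis N_ge : 100 <= N.

Lemma evf_length l : size l <= N ->
  evf "length" [:: vtuple l] (VNum (size l)) ((size l).+1 * (20 * N)).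
Proof.
elim: l => [|x l IHl] size_l.
  evf_auto fail => //; lia.
evf_auto ltac:(apply: IHl; exact: ltnW) => //; move: size_l => /=; lia.
Qed.

Lemma evf_nth l i : i < size l <= N ->
  evf "nth" [:: vtuple l; VNum i] (VNum (nth 0 l i)) (i.+1 * (20 * N)).
Proof.
elim: l i => [|x l IHl] [|i] //= size_l.
  evf_auto fail => //; lia.
evf_auto ltac:(apply: (evf_args (args' := [:: vtuple l; VNum i]));
  [by rewrite subn1 | apply: IHl; lia]) => //; lia.
Qed.

Lemma evf_remove_at l i : i < size l <= N ->
  evf "remove_at" [:: vtuple l; VNum i] (vtuple (remove_at l i)) (i.+1 * (20 * N)).
Proof.
elim: l i => [|x l IHl] [|i] //= size_l.
  evf_auto fail => //; rewrite /remove_at /= ?drop0 //; lia.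
evf_auto ltac:(apply: (evf_args (args' := [:: vtuple l; VNum i]));
  [by rewrite subn1 | apply: IHl; lia]) => //; lia.
Qed.

Lemma evf_insert x l : sorted leq l -> x <= N -> all (leq^~ N) l ->
  evf "insert" [:: VNum x; vtuple l] (vtuple (sort leq (x :: l))) ((size l).+1 * (20 * N)).
Proof.
move=> + x_N; elim: l => [|y l IHl] //= l_sorted l_N.
  evf_auto fail => //; lia.
have {l_N} [y_N l_N] := andP l_N.
have l_sorted' := path_sorted l_sorted.
evf_auto ltac:(apply: IHl => //) => //; last lia.
case: (leqP x y) => x_y.
  by rewrite (sorted_sort leq_trans) //= x_y l_sorted.
rewrite -[VCons _ _]/(vtuple (y :: sort leq (x :: l))); congr vtuple.
apply: (sorted_eq leq_trans anti_leq).
- rewrite /= path_min_sorted ?sort_sorted //; try exact: leq_total.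
  apply/allP => z; rewrite mem_sort inE => /orP[/eqP->|]; first lia.
  by apply/allP; apply: sorted_leq_all.
- exact/sort_sorted/leq_total.
rewrite [X in perm_eq _ X]/= perm_sym perm_sort perm_sym.
apply: (perm_trans _ (permEl (perm_catCA [:: y] [:: x] l))).
by rewrite perm_cons perm_sort.
Qed.

Lemma evf_sort l : size l <= N -> all (leq^~ N) l ->
  evf "sort" [:: vtuple l] (vtuple (sort leq l)) ((size l).+1 * ((size l).+1 * (20 * N))).
Proof.
elim: l => [|x l IHl] //= size_l l_N.
  evf_auto fail => //; lia.
have {l_N} [x_N l_N] := andP l_N.
evf_auto ltac:(first [apply: IHl => //; lia | eapply evf_insert => //]) => //=.
- exact/sort_sorted/leq_total.
- by rewrite all_sort.
- congr vtuple; apply/(perm_sortP leq_total leq_trans anti_leq).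
  by rewrite perm_cons perm_sort.
- rewrite size_sort; set K := 20 * N; have K_ge : 100 <= K by rewrite /K; lia.
  lia.
Qed.

Lemma evf_count_lt x l : x <= N -> size l <= N -> all (leq^~ N) l ->
  evf "count_lt" [:: VNum x; vtuple l] (VNum (count (fun y => y < x) l))
    ((size l).+1 * (20 * N)).
Proof.
move=> x_N; elim: l => [|y l IHl] //= size_l l_N.
  evf_auto fail => //; lia.
have {l_N} [y_N l_N] := andP l_N.
evf_auto ltac:(apply: IHl => //; lia).
- by rewrite addn1; case: ifP.
- have := count_size (fun y => y < x) l; case: ifP => _; lia.
Qed.

Lemma evf_count_eq x l : x <= N -> size l <= N -> all (leq^~ N) l ->
  evf "count_eq" [:: VNum x; vtuple l] (VNum (count_mem x l)) ((size l).+1 * (20 * N)).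
Proof.
move=> x_N; elim: l => [|y l IHl] //= size_l l_N.
  evf_auto fail => //; lia.
have {l_N} [y_N l_N] := andP l_N.
evf_auto ltac:(apply: IHl => //; lia).
- by case: ifP.
- have : count_mem x l <= @size nat l := count_size _ _.
  by move: (count_mem x l) => c; case: ifP => _; lia.
Qed.

Lemma evf_equal l l' : size l <= N -> all (leq^~ N) l -> all (leq^~ N) l' ->
  evf "equal" [:: vtuple l; vtuple l'] (VNum (l == l')) ((size l).+1 * (20 * N)).
Proof.
elim: l l' => [|x l IHl] [|x' l'] //= size_l l_N l'_N; try by evf_auto fail => //; lia.
have {l_N} [x_N l_N] := andP l_N; have {l'_N} [x'_N l'_N] := andP l'_N.
evf_auto ltac:(apply: IHl => //; lia).
- by rewrite eqseq_cons; case: (x == x').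
- lia.
Qed.

Lemma evf_max_all x l : x <= N -> size l <= N -> all (leq^~ N) l ->
  evf "max_all" [:: VNum x; vtuple l] (vtuple (map (maxn x) l)) ((size l).+1 * (20 * N)).
Proof.
move=> x_N; elim: l => [|y l IHl] //= size_l l_N.
  evf_auto fail => //; lia.
have {l_N} [y_N l_N] := andP l_N.
evf_auto ltac:(apply: IHl => //; lia).
- rewrite /vtuple /=; congr VCons.
  by case: leqP => x_y; congr VNum; lia.
- lia.
Qed.

Lemma evf_Lam t b : t <= N -> size b <= N -> all (leq^~ N) b ->
  evf "Lam" [:: VNum t; vtuple b] (VNum (Lam t b)) ((size b).+1 * (20 * N)).
Proof.
move=> t_N; elim: b => [|y l IHl] //= size_l l_N.
  evf_auto fail => //; lia.
have {l_N} [y_N l_N] := andP l_N.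
evf_auto ltac:(apply: IHl => //; lia).
- by rewrite /Lam /=; case: ifP.
- have := count_size (fun x => t + 2 <= x) l; rewrite /Lam; case: ifP => _; lia.
Qed.

Lemma evf_Gam s b : s <= N -> size b <= N -> all (leq^~ N) b ->
  evf "Gam" [:: VNum s; vtuple b] (VNum (Gam s b)) ((size b).+1 * (20 * N)).
Proof.
move=> s_N; elim: b => [|y l IHl] //= size_l l_N.
  evf_auto fail => //; lia.
have {l_N} [y_N l_N] := andP l_N.
evf_auto ltac:(apply: IHl => //; lia).
- by rewrite /Gam /=; case: ifP.
- have := count_size (fun x => x + 2 <= s) l; rewrite /Gam; case: ifP => _; lia.
Qed.

End ListFunctions.

(** * Large numbers and factorials *)

Lemma bits_exp m e : m <= 2 ^ e -> bits m <= e.+1.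
Proof.
move=> m_e; rewrite /bits ltnS; case: m m_e => [|m] m_e; first by rewrite trunc_log0.
by rewrite -(leq_exp2l _ _ (ltnSn 1)) (leq_trans (trunc_logP _ _)).
Qed.

(** Via m! <= m^m <= (2^m)^m. *)
Lemma fact_exp m : m`! <= 2 ^ (m ^ 2).
Proof.
case: m => // k; move: k.+1 (ltn0Sn k) => {k} m m_gt0.
apply: leq_trans (_ : m ^ m <= _); last first.
  rewrite -mulnn expnM leq_exp2r //.
  exact: ltnW (ltn_expl m (ltnSn 1)).
elim: m {m_gt0} => // m IHm; rewrite factS expnS leq_mul2l (leq_trans IHm) //.
by case: m {IHm} => // m; rewrite leq_exp2r.
Qed.

Section BigNumbers.
Local Open Scope string_scope.
Local Open Scope nat_scope.
Variable N : nat.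
Hypothesis N_ge : 100 <= N.

(* An upper bound for all numbers in the computation; [op_cost] bounds the cost of
   one arithmetic operation on such numbers. *)
Definition num_bound := 2 ^ (N ^ 3).
Definition op_cost := N ^ 9.

Lemma leq_num_bound m : m <= 10 * N -> m <= num_bound.
Proof.
move=> m_N; apply: leq_trans (ltnW (ltn_expl _ (ltnSn 1))) _; rewrite leq_exp2l //.
apply: leq_trans m_N (leq_trans (_ : _ <= N ^ 2) _); last by rewrite leq_pexp2l //; lia.
by rewrite -mulnn; nia.
Qed.

Lemma exp_num_bound e : e <= N ^ 3 -> 2 ^ e <= num_bound.
Proof. by move=> e_N; rewrite leq_exp2l. Qed.

Lemma fact_num_bound m : m <= N -> m`! <= num_bound.
Proof.
move=> m_N; apply: leq_trans (fact_exp m) _; apply: exp_num_bound.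
by apply: leq_trans (_ : N ^ 2 <= _); rewrite ?leq_exp2r // leq_pexp2l //; lia.
Qed.

Lemma ev_big env o e1 e2 m n w C1 C2 d :
  ev env e1 (VNum m) C1 -> ev env e2 (VNum n) C2 ->
  eval2 o (VNum m) (VNum n) = Some (w, d) -> m <= num_bound -> n <= num_bound ->
  ev env (Op2 o e1 e2) w (C1 + C2 + op_cost).
Proof.
move=> ev1 ev2 eq_w /bits_exp m_W /bits_exp n_W.
apply: ev_le (ev_op2 ev1 ev2 eq_w) _.
(* For bit lengths a and b, (a+2)(b+2) dominates both a+b and ab, so all operations are treated at
   once. The resulting (N^3+3)^2 fits below N^9. *)
have d_le : d <= (bits m).+2 * (bits n).+2.
  by case: o eq_w => // -[_ <-]; nia.
have : d <= (N ^ 3).+3 * (N ^ 3).+3 by apply: leq_trans d_le (leq_mul _ _).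
have : (N ^ 3).+3 * (N ^ 3).+3 < op_cost; last lia.
rewrite /op_cost -[9]/(3 + 3 + 3) !expnD.
have : 100 <= N ^ 3 by rewrite (leq_trans N_ge) // -{1}(expn1 N) leq_pexp2l //; lia.
move: (N ^ 3) => y; nia.
Qed.

End BigNumbers.

Ltac arith_big N_ge rec :=
  eapply (ev_big N_ge);
  [rec | rec | reflexivity | try solve [apply: (leq_num_bound N_ge); lia]
                           | try solve [apply: (leq_num_bound N_ge); lia]].
Ltac evf_big N_ge call :=
  eapply evf_intro;
  [reflexivity | reflexivity | cbn [zip]; ev_auto ltac:(arith_big N_ge) call | | ].

Section Binomials.
Local Open Scope string_scope.
Local Open Scope nat_scope.
Variable N : nat.
Hypothesis N_ge : 100 <= N.

Lemma op_cost_ge : 100 <= op_cost N.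
Proof. by rewrite (leq_trans N_ge) // -{1}(expn1 N) leq_pexp2l //; lia. Qed.

Lemma evf_fact m : m <= N -> evf "fact" [:: VNum m] (VNum m`!) (m.+1 * (4 * op_cost N)).
Proof.
have op_cost_ge := op_cost_ge; elim: m => [|m IHm] m_N.
  by evf_big N_ge fail => //; lia.
evf_big N_ge ltac:(apply: (evf_args (args' := [:: VNum m])); [by rewrite subn1 | apply: IHm; lia]).
all: try (apply: leq_num_bound; lia).
- by apply: fact_num_bound => //; lia.
- by rewrite factS.
- lia.
Qed.

Lemma evf_binom m l : l <= m <= N ->
  evf "binom" [:: VNum m; VNum l] (VNum 'C(m, l)) (N.+1 * (20 * op_cost N)).
Proof.
have op_cost_ge := op_cost_ge; move=> l_m.
evf_big N_ge ltac:(apply: evf_fact; lia).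
all: try (apply: leq_num_bound; lia).
all: try (apply: fact_num_bound; lia).
- apply: leq_trans (fact_num_bound (m := m) N_ge _); last lia.
  by rewrite -(@bin_fact m l) ?leq_pmull ?bin_gt0 //; lia.
- by rewrite -(@bin_fact m l) ?mulnK ?muln_gt0 ?fact_gt0 //; lia.
- nia.
Qed.
End Binomials.

(** * The memoized recursion *)

(* A table is represented by its keys, since they determine the stored values. *)
Definition key : Type := (seq nat * nat * nat * nat)%type.

Definition entry (q : key) : value :=
  let: (b, s, t, k) := q in
  VCons (vtuple b) (VCons (VNum s) (VCons (VNum t) (VCons (VNum k) (VNum (Q b s t k))))).

Definition table (T : seq key) : value := vlist (map entry T).

Definition small_key N (q : key) : bool :=
  let: (b, s, t, k) := q in
  [&& size b <= N, all (leq^~ N) b, s <= N, t <= N & k <= N].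

Lemma Q_le_exp b s t k : Q b s t k <= 2 ^ size b.
Proof.
rewrite /Q -[X in 2 ^ X]card_ord -cardsT -card_powerset; apply: subset_leq_card.
by apply/subsetP => I _; rewrite powersetE subsetT.
Qed.

Section Memo.
Local Open Scope string_scope.
Local Open Scope nat_scope.
Variable N : nat.
Hypothesis N_ge : 100 <= N.

Lemma Q_num_bound b s t k : size b <= N -> Q b s t k <= num_bound N.
Proof.
move=> b_N; apply: leq_trans (Q_le_exp _ _ _ _) _; apply: exp_num_bound => //.
by apply: leq_trans b_N _; rewrite -{1}(expn1 N) leq_pexp2l //; lia.
Qed.

Lemma evf_find T b s t k : all (small_key N) T -> small_key N (b, s, t, k) ->
  evf "find" [:: table T; vtuple b; VNum s; VNum t; VNum k]
    (if (b, s, t, k) \in T then VCons (VNum (Q b s t k)) VNil else VNil)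
    ((size T).+1 * (50 * N * N)).
Proof.
move=> T_N /and5P[size_b b_N s_N t_N k_N].
elim: T T_N => [|[[[b' s'] t'] k'] T IHT] /=.
  by move=> _; evf_auto fail => //; nia.
case/andP=> /and5P[size_b' b'_N s'_N t'_N k'_N] {}/IHT IHT.
evf_auto ltac:(first [apply: (evf_equal N_ge) => // | apply: IHT]).
- have eq_key : ((b, s, t, k) == (b', s', t', k')) = [&& k == k', s == s', t == t' & b == b'].
    by apply/eqP/and4P => [[-> -> -> ->]|[/eqP-> /eqP-> /eqP-> /eqP->]].
  rewrite inE eq_key; case: and4P => //= -[/eqP-> /eqP-> /eqP-> /eqP->].
  by [].
- have : (size b).+1 * (20 * N) <= N.+1 * (20 * N) by rewrite leq_mul2r ltnS size_b orbT.
  nia.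
Qed.

Lemma evf_store b s t k v T :
  evf "store" [:: vtuple b; VNum s; VNum t; VNum k; VCons (VNum v) T]
   (VCons (VNum v) (VCons (VCons (vtuple b) (VCons (VNum s) (VCons (VNum t)
      (VCons (VNum k) (VNum v))))) T)) 50.
Proof. by evf_auto fail. Qed.

(** The cost of one activation of [Qmemo] apart from its recursive calls: [length], [find],
    [max_all] and a bounded number of operations, each within [op_cost N]. *)
Definition memo_cost := 30 * op_cost N.

Definition memo_entry b s t k (v : nat) : value :=
  VCons (vtuple b) (VCons (VNum s) (VCons (VNum t) (VCons (VNum k) (VNum v)))).

Ltac memo_start := eapply evf_intro; [reflexivity | reflexivity | cbn [zip] | | ].
Ltac memo_auto call := ev_auto ltac:(arith_big N_ge) call.

Lemma evf_Qmemo_0 b s t T :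
  evf "Qmemo" [:: vtuple b; VNum s; VNum t; VNum 0; T] (VCons (VNum 1) T) memo_cost.
Proof.
memo_start.
- by eapply ev_if_holds; [memo_auto fail | | memo_auto fail].
- by [].
- have := op_cost_ge N_ge; rewrite /memo_cost; lia.
Qed.

Section MemoCall.
Variables (b : seq nat) (s t k : nat) (T : value).
Hypotheses (size_b : size b <= N) (s_N : s <= N) (t_N : t < N).
Hypotheses (k_gt0 : 0 < k) (k_N : k <= N).

Let len_X : (size b).+1 * (20 * N) <= op_cost N.
Proof.
apply: leq_trans (_ : N.+1 * (20 * N) <= _); first by rewrite leq_mul2r ltnS size_b orbT.
apply: leq_trans (_ : N ^ 3 <= _); first by rewrite !expnS; nia.
by rewrite leq_pexp2l //; lia.
Qed.

Lemma evf_Qmemo_out : (t.+1 - s < k) || (size b < k) ->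
  evf "Qmemo" [:: vtuple b; VNum s; VNum t; VNum k; T] (VCons (VNum 0) T) memo_cost.
Proof.
move=> out; memo_start.
- eapply ev_if_fails; [memo_auto fail | by rewrite -lt0n | ].
  eapply ev_if_holds; [memo_auto ltac:(exact: (evf_length N_ge)) | by rewrite !addn1 | memo_auto fail].
- by [].
- have := op_cost_ge N_ge; rewrite /memo_cost; lia.
Qed.

Hypothesis in_range : ~~ ((t.+1 - s < k) || (size b < k)).
Variable C : nat.

Lemma evf_Qmemo_found v :
  evf "find" [:: T; vtuple b; VNum s; VNum t; VNum k] (VCons v VNil) C ->
  C <= op_cost N ->
  evf "Qmemo" [:: vtuple b; VNum s; VNum t; VNum k; T] (VCons v T) memo_cost.
Proof.
move=> found C_X; memo_start.
- eapply ev_if_fails; [memo_auto fail | by rewrite -lt0n | ].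
  eapply ev_if_fails; [memo_auto ltac:(exact: (evf_length N_ge)) | by rewrite !addn1 | ].
  eapply ev_let; [memo_auto ltac:(exact: found) | ].
  by eapply ev_if_false; memo_auto fail.
- by [].
- have := op_cost_ge N_ge; rewrite /memo_cost; lia.
Qed.

Hypothesis b_N : all (leq^~ N) b.
Hypothesis not_found : evf "find" [:: T; vtuple b; VNum s; VNum t; VNum k] VNil C.
Hypothesis C_X : C <= op_cost N.

(** The part common to the three recursive cases: both guards fail, the search finds nothing, and
    the branch computing the last argument of [store] remains to be evaluated. *)
Ltac memo_miss :=
  memo_start;
  [ eapply ev_if_fails; [memo_auto fail | by rewrite -lt0n | ];
    eapply ev_if_fails; [memo_auto ltac:(exact: (evf_length N_ge)) | by rewrite !addn1 | ];
    eapply ev_let; [memo_auto ltac:(exact: not_found) | ];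
    eapply ev_if_true; [memo_auto fail | ];
    eapply ev_call;
    [ do 4! (eapply evs_cons; [memo_auto fail | ]);
      eapply evs_cons; [ | exact: evs_nil]
    | eapply evf_store ]
  | unfold memo_entry; reflexivity
  | ].

Lemma evf_Qmemo_lt x b' v T' C' : b = x :: b' -> x < s ->
  evf "Qmemo" [:: vtuple b'; VNum s; VNum t; VNum k; T] (VCons (VNum v) T') C' ->
  evf "Qmemo" [:: vtuple b; VNum s; VNum t; VNum k; T]
    (VCons (VNum v) (VCons (memo_entry b s t k v) T')) (memo_cost + C').
Proof.
move=> b_eq; move: b_N; rewrite b_eq /= => /andP[x_N _] x_s rec; rewrite -b_eq; memo_miss.
  rewrite b_eq; eapply ev_if_holds; [memo_auto fail | by rewrite addn1 | ].
  memo_auto ltac:(exact: rec).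
have := op_cost_ge N_ge; rewrite /memo_cost; lia.
Qed.

Lemma evf_Qmemo_gt x b' v T' C' : b = x :: b' -> s < x ->
  evf "Qmemo" [:: vtuple b; VNum s.+1; VNum t; VNum k; T] (VCons (VNum v) T') C' ->
  evf "Qmemo" [:: vtuple b; VNum s; VNum t; VNum k; T]
    (VCons (VNum v) (VCons (memo_entry b s t k v) T')) (memo_cost + C').
Proof.
move=> b_eq; move: b_N; rewrite b_eq /= => /andP[x_N _] s_x; rewrite -b_eq => rec; memo_miss.
  rewrite b_eq; eapply ev_if_fails; [memo_auto fail | by rewrite addn1 -leqNgt ltnW | ].
  eapply ev_if_holds; [memo_auto fail | by rewrite addn1 | ].
  rewrite -b_eq; memo_auto ltac:(by rewrite addn1; exact: rec).
have := op_cost_ge N_ge; rewrite /memo_cost; lia.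
Qed.

Lemma evf_Qmemo_eq b' v1 v2 T1 T2 C1 C2 : b = s :: b' -> v1 <= num_bound N -> v2 <= num_bound N ->
  evf "Qmemo" [:: vtuple (map (maxn s.+1) b'); VNum s.+1; VNum t; VNum k.-1; T]
    (VCons (VNum v1) T1) C1 ->
  evf "Qmemo" [:: vtuple b'; VNum s; VNum t; VNum k; T1] (VCons (VNum v2) T2) C2 ->
  evf "Qmemo" [:: vtuple b; VNum s; VNum t; VNum k; T]
    (VCons (VNum (v1 + v2)) (VCons (memo_entry b s t k (v1 + v2)) T2))
    (memo_cost + C1 + C2).
Proof.
move=> b_eq v1_W v2_W; move: b_N size_b len_X.
rewrite b_eq /= => /andP[x_N b'_N] size_b' len_X'; rewrite -b_eq => rec1 rec2.
have b'_size : size b' <= N by exact: ltnW.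
have len_b' : (size b').+1 * (20 * N) <= op_cost N.
  by apply: leq_trans len_X'; rewrite leq_mul2r ltnS leqnSn orbT.
memo_miss.
  rewrite b_eq; eapply ev_if_fails; [memo_auto fail | by rewrite addn1 ltnn | ].
  eapply ev_if_fails; [memo_auto fail | by rewrite addn1 ltnn | ].
  memo_auto ltac:(first [ apply: (evf_max_all N_ge) => //; lia
                        | rewrite addn1 subn1; exact: rec1 | exact: rec2]).
  exact: v1_W.
  exact: v2_W.
have := op_cost_ge N_ge; rewrite /memo_cost; lia.
Qed.
End MemoCall.

Section Fixed.
Variables (b0 : seq nat) (t : nat).
Hypothesis b0_sorted : sorted leq b0.
Hypothesis b0_pos : all (leq 1) b0.
Hypothesis b0_N : all (leq^~ N) b0.
Hypothesis size_b0 : size b0 <= N.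
Hypothesis t_N : t < N.

(* The first argument of every recursive call is a suffix of [b0] whose entries were
   raised to at least some w <= s. *)
Definition reach (b : seq nat) (s : nat) : Prop :=
  exists w j, [/\ b = map (maxn w) (drop j b0), w <= s & j <= size b0].

(** The recursion never changes t, and a tuple is given by its level w and its offset j, so four
    indices up to N describe a key. Repetitions in the list are harmless: its length only bounds the
    number of distinct keys. *)
Definition universe : seq key :=
  [seq (q.1.1, q.1.2, t, q.2) | q <- [seq (p, k) | p <- [seq (b, s) |
      b <- [seq map (maxn w) (drop j b0) | w <- iota 0 N.+1, j <- iota 0 N.+1],
      s <- iota 0 N.+1], k <- iota 0 N.+1]].

Lemma size_universe : size universe = N.+1 * N.+1 * N.+1 * N.+1.
Proof. by rewrite size_map !size_allpairs !size_iota. Qed.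

Lemma mem_universe b s k : reach b s -> s <= N -> k <= N -> (b, s, t, k) \in universe.
Proof.
move=> [w [j [-> w_s j_b]]] s_N k_N.
apply/mapP; exists (map (maxn w) (drop j b0), s, k) => //.
apply: allpairs_f; last by rewrite mem_iota; lia.
apply: allpairs_f; last by rewrite mem_iota; lia.
by apply: allpairs_f; rewrite mem_iota; lia.
Qed.

Lemma reach_sorted b s : reach b s -> sorted leq b.
Proof.
move=> [w [j [-> _ _]]]; apply: (homo_sorted (e := leq)); last exact: drop_sorted.
by move=> x y x_y; lia.
Qed.

Lemma reach_all b s : 0 < s -> s <= N -> reach b s -> all (leq 1) b /\ all (leq^~ N) b.
Proof.
move=> s_gt0 s_N [w [j [-> w_s _]]]; rewrite !all_map; split; apply/allP => x /mem_drop x_b /=.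
  by have := allP b0_pos x x_b; lia.
by have /= := allP b0_N x x_b; lia.
Qed.

Lemma reach_size b s : reach b s -> size b <= N.
Proof. by move=> [w [j [-> _ _]]]; rewrite size_map size_drop; lia. Qed.

Lemma reach_behead x b s : reach (x :: b) s -> reach b s.
Proof.
move=> [w [j [e w_s j_b]]]; exists w, j.+1.
have j_lt : j < size b0.
  by move: (congr1 size e); rewrite size_map size_drop /=; lia.
by move: e; rewrite (drop_nth 0 j_lt) /= => -[_ ->].
Qed.

Lemma reachS b s : reach b s -> reach b s.+1.
Proof. by move=> [w [j [-> w_s j_b]]]; exists w, j; split=> //; lia. Qed.

(** Raising to w and then to s+1 > w amounts to raising to s+1 alone. This collapse of iterated [U]
    is what keeps the number of tuples polynomial. *)
Lemma reach_max b s : reach b s -> reach (map (maxn s.+1) b) s.+1.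
Proof.
move=> [w [j [-> w_s j_b]]]; exists s.+1, j; split=> //.
by rewrite -map_comp; apply: eq_map => x /=; lia.
Qed.

Definition good_table (T : seq key) : bool := uniq T && all (mem universe) T.

Lemma good_table_size T : good_table T -> size T <= N.+1 * N.+1 * N.+1 * N.+1.
Proof.
case/andP=> T_uniq /allP T_sub; rewrite -size_universe.
exact: uniq_leq_size.
Qed.

Lemma good_table_small T : good_table T -> all (small_key N) T.
Proof.
case/andP=> _; apply: sub_all => q /mapP[q1 /allpairsP[[q2 k] [/allpairsP[[b s] [/allpairsP[[w j]]]]]]].
rewrite ![_.1]/= ![_.2]/= => -[w_N j_N ->] s_N -> k_N -> ->.
move: w_N j_N s_N k_N; rewrite !mem_iota => w_N j_N s_N k_N /=; apply/and5P; split; try lia.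
  by rewrite size_map size_drop; lia.
by rewrite all_map; apply/allP => x /mem_drop /(allP b0_N) /=; lia.
Qed.

(** The measure that decreases in every recursive call; it is unrelated to rank functions. *)
Definition rank (q : key) : nat := let: (b, s, t, _) := q in size b + (t.+1 - s).

Lemma good_table_cons q T : q \in universe -> q \notin T -> good_table T -> good_table (q :: T).
Proof. by move=> q_U q_T /andP[T_uniq T_U]; rewrite /good_table /= q_T T_uniq q_U. Qed.

(** Such a table has at most (N+1)^4 <= 2N^4 entries, and comparing a key costs of the order of N^2,
    so a search stays below N^9. *)
Lemma memo_bounds T : good_table T ->
  [/\ (size T).+1 * (50 * N * N) <= op_cost N, N.+1 * (20 * N) <= op_cost N & 1000 <= op_cost N].
Proof.
move=> /good_table_size size_T.
have N2 : N.+1 * (20 * N) <= N ^ 3 by rewrite !expnS; nia.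
have -> : op_cost N = N ^ 6 * N ^ 3 by rewrite -expnD.
have N3 : 1000 <= N ^ 3 by rewrite (leq_trans _ (_ : 100 ^ 3 <= _)) ?leq_exp2r.
have N6 : 0 < N ^ 6 by rewrite expn_gt0; lia.
split; [|nia|nia].
have N4 : N.+1 * N.+1 * N.+1 * N.+1 <= 2 * (N * N * (N * N)).
  have N2' : N.+1 * N.+1 * 100 <= 103 * (N * N) by nia.
  rewrite -mulnA; move: N2'; move: (N.+1 * N.+1) (N * N) => A M le_AM.
  have := leq_mul le_AM le_AM; lia.
have {}size_T := leq_trans size_T N4.
have -> : N ^ 6 = N * N * (N * N) * (N * N) by rewrite -[6]/(2 + 2 + 2) !expnD -!mulnn.
have M_gt0 : 0 < N * N * (N * N) by rewrite !muln_gt0; lia.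
rewrite -mulnA mulnA [X in _ <= X]mulnAC leq_mul2r; apply/orP; right.
apply: leq_trans (leq_mul (leqnn _) N3).
lia.
Qed.

Ltac key_lia :=
  repeat match goal with
  | H : is_true (good_table _) |- _ => clear H
  | H : is_true (_ \in universe) |- _ => clear H
  | H : is_true (small_key _ _) |- _ => clear H
  end; lia.

(** A call that misses adds its own key, and for two recursive calls adding x and y keys, 1 + (2x+1)
    + (2y+1) = 2(x+y+1) + 1; this is why the cost has the form 2 * size new + 1. The bound on [rank]
    serves distinctness: the recursive calls add only keys of smaller rank, so the key stored
    afterwards is not among them. *)
Lemma evf_Qmemo m b s k T :
  size b + (t.+1 - s) <= m -> reach b s -> 0 < s <= N -> k <= N -> good_table T ->
  exists new, [/\ evf "Qmemo" [:: vtuple b; VNum s; VNum t; VNum k; table T]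
      (VCons (VNum (Q b s t k)) (table (new ++ T))) (memo_cost * (2 * size new).+1),
    good_table (new ++ T) & all (fun q => rank q <= size b + (t.+1 - s)) new].
Proof.
(* The prelude serves both cases of the induction and settles k = 0 and arguments out of range. For
   m = 0 nothing else remains, since a call in range with k > 0 has s <= t. *)
elim: m b s k T => [|m IHm] b s k T m_le b_reach s_range k_N T_good;
  have [find_X N2_X op_cost_ge] := memo_bounds T_good;
  have [s_gt0 s_N] := andP s_range;
  have [b_pos b_N] := reach_all s_gt0 s_N b_reach;
  have b_sorted := reach_sorted b_reach;
  have size_b := reach_size b_reach;
  have recE := Q_recursionE t k b_sorted b_pos s_gt0;
  (case: (posnP k) => [k0|k_gt0];
    [by exists [::]; split=> //; rewrite k0 Q0 //= muln0 muln1; apply: evf_Qmemo_0|]);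
  (case: (boolP ((t.+1 - s < k) || (size b < k))) => [out|in_range];
    [exists [::]; split=> //; rewrite recE /Q_recursion -[k == 0]negbK -lt0n k_gt0 out;
     by rewrite /= muln0 muln1; apply: evf_Qmemo_out|]); first lia.
have find_ev := @evf_find T b s t k (good_table_small T_good).
have small_q : small_key N (b, s, t, k) by apply/and5P; split=> //; exact: ltnW.
move: find_ev; case: ifP => [q_T|/negbT q_T] /(_ small_q) find_ev.
  exists [::]; split=> //; rewrite /= muln0 muln1.
  exact: evf_Qmemo_found find_ev find_X.
clear N2_X op_cost_ge; move: find_ev find_X; move: (_ * (50 * N * N)) => C find_ev find_X.
have q_U : (b, s, t, k) \in universe by apply: mem_universe.
have new_q new : all (fun q => rank q < size b + (t.+1 - s)) new ->
    (b, s, t, k) \notin new ++ T.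
  move=> /allP rank_new; rewrite mem_cat negb_or q_T andbT.
  by apply/negP => /rank_new /=; rewrite ltnn.
move: recE; rewrite /Q_recursion -[k == 0]negbK -lt0n k_gt0 (negPf in_range) [~~ true]/=.
case b_eq: b => [|x b']; first by move: in_range; rewrite b_eq /=; key_lia.
rewrite -b_eq [X in behead (U X)]b_eq behead_U -?b_eq //.
rewrite [X in head _ X]b_eq ![X in behead X]b_eq [head _ _]/= [behead _]/=.
have b'_reach : reach b' s by apply: (@reach_behead x); rewrite -b_eq.
have size_b' : size b = (size b').+1 by rewrite b_eq.
case: (ltngtP x s) => [x_s|s_x|x_s] recE.
- have [|new [ev1 good1 rank1]] := IHm b' s k T _ b'_reach s_range k_N T_good; first key_lia.
  exists ((b, s, t, k) :: new); split.
  + apply: evf_le (_ : evf _ _ _ (memo_cost + memo_cost * (2 * size new).+1)) _; last first.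
      by rewrite /= -mulnS leq_mul2l; key_lia.
    rewrite /table /= -/(table (new ++ T)) recE.
    exact: (evf_Qmemo_lt _ _ _ _ _ in_range b_N find_ev find_X b_eq x_s ev1).
  + apply: good_table_cons => //; apply: new_q.
    by apply: sub_all rank1 => q; rewrite size_b'; key_lia.
  + by rewrite /= leqnn; apply: sub_all rank1 => q; rewrite size_b'; key_lia.
- have s_lt : s.+1 <= N by move: in_range; key_lia.
  have [|new [ev1 good1 rank1]] := IHm b s.+1 k T _ (reachS b_reach) s_lt k_N T_good.
    by move: in_range; key_lia.
  exists ((b, s, t, k) :: new); split.
  + apply: evf_le (_ : evf _ _ _ (memo_cost + memo_cost * (2 * size new).+1)) _; last first.
      by rewrite /= -mulnS leq_mul2l; key_lia.
    rewrite /table /= -/(table (new ++ T)) recE.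
    exact: (evf_Qmemo_gt _ _ _ _ _ in_range b_N find_ev find_X b_eq s_x ev1).
  + apply: good_table_cons => //; apply: new_q.
    by apply: sub_all rank1 => q; move: in_range; key_lia.
  + by rewrite /= leqnn; apply: sub_all rank1 => q; key_lia.
rewrite x_s in b_eq recE.
have s_lt : s.+1 <= N by move: in_range; key_lia.
have max_reach := reach_max b'_reach.
have k1_N : k.-1 <= N by key_lia.
have [|new1 [ev1 good1 rank1]] := IHm _ s.+1 k.-1 T _ max_reach s_lt k1_N T_good.
  by rewrite size_map; move: in_range; key_lia.
have [|new2 [ev2 good2 rank2]] := IHm b' s k (new1 ++ T) _ b'_reach s_range k_N good1; first key_lia.
exists ((b, s, t, k) :: new2 ++ new1); rewrite /= -catA; split.
+ apply: evf_le (_ : evf _ _ _ (memo_cost + memo_cost * (2 * size new1).+1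
      + memo_cost * (2 * size new2).+1)) _; last first.
    by rewrite /= -mulnS -mulnDr leq_mul2l size_cat; key_lia.
  rewrite /table /= -/(table _) recE subn1.
  apply: (evf_Qmemo_eq _ _ _ _ _ in_range b_N find_ev find_X b_eq _ _ ev1 ev2) => //.
    by apply: Q_num_bound; rewrite size_map; key_lia.
  by apply: Q_num_bound; key_lia.
+ apply: good_table_cons => //; rewrite catA; apply: new_q.
  rewrite all_cat; apply/andP; split; [apply: sub_all rank2|apply: sub_all rank1] => q;
    by rewrite ?size_map; move: in_range; key_lia.
+ rewrite leqnn /= all_cat; apply/andP; split; [apply: sub_all rank2|apply: sub_all rank1] => q;
    by rewrite ?size_map; move: in_range; key_lia.
Qed.

End Fixed.
End Memo.

Section Formula.
Local Open Scope string_scope.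
Local Open Scope nat_scope.
Variable N : nat.
Hypothesis N_ge : 100 <= N.

(** * The formula *)

(* A definition, to keep [lia] from expanding [N ^ k]. *)
Definition budget k := N ^ k.

(** From the empty table at most (N+1)^4 <= N^5 keys are added, at a cost of the order of N^9 each;
    the last factor N absorbs the constants. *)
Lemma evf_Q b s t k :
  sorted leq b -> all (leq 1) b -> all (leq^~ N) b -> size b <= N ->
  0 < s <= N -> t < N -> k <= N ->
  evf "Q" [:: vtuple b; VNum s; VNum t; VNum k] (VNum (Q b s t k)) (budget 15).
Proof.
move=> b_sorted b_pos b_N size_b s_range t_N k_N.
have b_reach : reach b b s.
  exists 0, 0; split=> //; rewrite drop0 -[LHS]map_id; apply: eq_map => x.
  by rewrite max0n.
have [new [ev_memo good _]] := evf_Qmemo N_ge b_sorted b_pos b_N size_b t_N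
  (leqnn _) b_reach s_range k_N (isT : good_table N b t [::]).
rewrite cats0 in ev_memo good.
evf_auto ltac:(exact: ev_memo) => //.
have := good_table_size good; set z := _ * _ * _ * _ => size_new.
have z_le : z <= N ^ 5.
  have N2 : N.+1 * N.+1 <= 2 * N ^ 2 by rewrite -mulnn; nia.
  apply: leq_trans (_ : 4 * N ^ 4 <= _).
    have -> : 4 * N ^ 4 = 2 * N ^ 2 * (2 * N ^ 2) by rewrite mulnACA -expnD.
    by rewrite /z -mulnA leq_mul.
  by rewrite [N ^ 5]expnS leq_mul2r; apply/orP; right; apply: leq_trans N_ge.
have N5 : 0 < N ^ 5 by rewrite expn_gt0; lia.
have -> : budget 15 = N * op_cost N * N ^ 5 by rewrite /budget /op_cost -expnS -expnD.
apply: leq_trans (_ : 100 * op_cost N * N ^ 5 <= _); last first.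
  by rewrite leq_mul2r leq_mul2r N_ge !orbT.
have := op_cost_ge N_ge; rewrite /memo_cost; move: (N ^ 5) N5 z_le (size new) size_new (op_cost N).
move=> y y_gt0 z_y x x_z w w_ge.
have : w * x <= w * y by rewrite leq_mul2l; lia.
have : w <= w * y by rewrite leq_pmulr.
lia.
Qed.

(** The index adds up under multiplication and grows by 1 for a sum of at most N terms. Factorials,
    binomials, values of [Q] and numbers up to N have index 1, and any index up to 100 stays within
    [num_bound N]. *)
Definition pow_bound i := 2 ^ (i * N ^ 2).

Lemma pow_boundM i j x y : x <= pow_bound i -> y <= pow_bound j -> x * y <= pow_bound (i + j).
Proof. by move=> x_V y_V; rewrite /pow_bound mulnDl expnD leq_mul. Qed.

Lemma leq_pow_bound m : m <= N -> m <= pow_bound 1.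
Proof.
move=> m_N; apply: leq_trans (ltnW (ltn_expl _ (ltnSn 1))) _; rewrite leq_exp2l //.
by apply: leq_trans m_N _; rewrite mul1n -mulnn; nia.
Qed.

Lemma pow_bound_num_bound i x : i <= 100 -> x <= pow_bound i -> x <= num_bound N.
Proof.
move=> i_le /leq_trans; apply; rewrite leq_exp2l // [N ^ 3]expnS leq_mul2r.
by rewrite (leq_trans i_le) ?orbT.
Qed.

Lemma sum_pow_bound k m n F : n <= N + m -> (forall i, m <= i < n -> F i <= pow_bound k) ->
  \sum_(m <= i < n) F i <= pow_bound k.+1.
Proof.
move=> n_N F_V; apply: leq_trans (_ : \sum_(m <= i < n) pow_bound k <= _).
  by rewrite !big_nat; apply: leq_sum.
rewrite sum_nat_const_nat -[k.+1]add1n; apply: pow_boundM => //.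
by apply: leq_pow_bound; lia.
Qed.

Lemma fact_pow_bound m : m <= N -> m`! <= pow_bound 1.
Proof.
by move=> m_N; apply: leq_trans (fact_exp m) _; rewrite leq_exp2l // mul1n leq_exp2r.
Qed.

Lemma bin_pow_bound m l : m <= N -> 'C(m, l) <= pow_bound 1.
Proof.
move=> m_N; case: (leqP l m) => [l_m|m_l]; last by rewrite bin_small.
apply: leq_trans (fact_pow_bound m_N).
by rewrite -(bin_fact l_m) leq_pmulr // muln_gt0 !fact_gt0.
Qed.

Lemma Q_pow_bound b s t k : size b <= N -> Q b s t k <= pow_bound 1.
Proof.
move=> b_N; apply: leq_trans (Q_le_exp _ _ _ _) _; rewrite leq_exp2l //.
by apply: leq_trans b_N _; rewrite mul1n -mulnn; nia.
Qed.

Lemma cost_bounds :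
  [/\ 100 <= op_cost N, 100 * op_cost N <= budget 12, N.+1 * (20 * op_cost N) <= budget 12,
      N.+1 * (20 * N) <= budget 12 & 100 * budget 12 <= budget 15].
Proof.
have op_cost_ge := op_cost_ge N_ge; split=> //.
- by rewrite /budget -[12]/(1 + (2 + 9)) expnD expn1 expnD leq_mul // leq_pmull // expn_gt0; lia.
- have -> : budget 12 = N * (N * N) * op_cost N by rewrite /budget /op_cost -!mulnA -!expnS.
  by rewrite mulnA leq_mul2r; apply/orP; right; nia.
- have -> : budget 12 = N * N * (N * op_cost N) by rewrite /budget /op_cost -!mulnA -!expnS.
  by apply: leq_mul; [nia | rewrite (mulnC 20) leq_mul2l; lia].
- by rewrite /budget -[15]/(3 + 12) expnD leq_mul2r (leq_trans N_ge) ?orbT // -{1}(expn1 N) leq_pexp2l //; lia.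
Qed.

Variables (n : nat) (b : seq nat).
Hypothesis n_N : 4 * n + 100 <= N.
Hypothesis b_sorted : sorted leq b.
Hypothesis b_pos : all (leq 1) b.
Hypothesis b_n : all (leq^~ n) b.
Hypothesis size_b : size b <= n.

Let b_N : all (leq^~ N) b.
Proof. by apply: sub_all b_n => x /=; lia. Qed.

Let size_b_N : size b <= N.
Proof. lia. Qed.

Let Lam_n t : Lam t b <= n.
Proof. exact: leq_trans (count_size _ _) size_b. Qed.

Let Gam_n s : Gam s b <= n.
Proof. exact: leq_trans (count_size _ _) size_b. Qed.

Definition Rterm s t l g :=
  'C(Lam t b, l) * Q b 1 (s - 2) g * (t.+1 - s + l + g)`! * (n + s - (t + l + g + 2))`!.

Let evf_fact12 m : m <= N -> evf "fact" [:: VNum m] (VNum m`!) (budget 12).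
Proof.
move=> m_N; apply: evf_le (evf_fact N_ge m_N) _; have [_ _ c _ _] := cost_bounds.
by apply: leq_trans c; apply: leq_mul; lia.
Qed.

Let evf_binom12 m l : l <= m <= N -> evf "binom" [:: VNum m; VNum l] (VNum 'C(m, l)) (budget 12).
Proof. by move=> l_m; apply: evf_le (evf_binom N_ge l_m) _; have [_ _ c _ _] := cost_bounds. Qed.

Lemma size_cost : (size b).+1 * (20 * N) <= budget 12.
Proof.
have [_ _ _ c _] := cost_bounds; apply: leq_trans c.
by rewrite leq_mul2r ltnS size_b_N orbT.
Qed.

Let evf_Lam12 t : t <= N -> evf "Lam" [:: VNum t; vtuple b] (VNum (Lam t b)) (budget 12).
Proof. by move=> t_N; apply: evf_le (evf_Lam N_ge t_N size_b_N b_N) size_cost. Qed.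

Let evf_Gam12 s : s <= N -> evf "Gam" [:: VNum s; vtuple b] (VNum (Gam s b)) (budget 12).
Proof. by move=> s_N; apply: evf_le (evf_Gam N_ge s_N size_b_N b_N) size_cost. Qed.

Section Terms.
Variables s t : nat.
Hypothesis s_range : 0 < s <= n.
Hypothesis t_n : t < n.

Ltac pow_bound_auto :=
  first [ apply: bin_pow_bound; lia | exact: Q_pow_bound | apply: fact_pow_bound; lia | apply: leq_pow_bound; lia
        | apply: (@pow_boundM 1 1); pow_bound_auto | apply: (@pow_boundM 2 2); pow_bound_auto ].

Lemma Rterm_pow_bound l g : l <= n -> g <= n -> Rterm s t l g <= pow_bound 4.
Proof.
move=> l_n g_n; rewrite /Rterm -mulnA; have Lam_t := Lam_n t.
pow_bound_auto.
Qed.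

Definition Rpartial l g := \sum_(0 <= g' < g.+1) Rterm s t l g'.

Lemma Rpartial_pow_bound l g : l <= n -> g <= n -> Rpartial l g <= pow_bound 5.
Proof.
move=> l_n g_n; apply: sum_pow_bound => [|g' g'_range]; first lia.
by apply: Rterm_pow_bound => //; lia.
Qed.

Lemma evf_Rsum_g l g : l <= Lam t b -> g <= Gam s b ->
  evf "Rsum_g" [:: VNum n; vtuple b; VNum s; VNum t; VNum l; VNum g]
    (VNum (Rpartial l g)) (g.+1 * (2 * budget 15)).
Proof.
move=> l_Lam; have Lam_t := Lam_n t; have Gam_s := Gam_n s.
have [c1 c2 _ _ c5] := cost_bounds.
have termE h : 'C(Lam t b, l) * Q b 1 (s - 2) h *
    ((t + 1 - s + l + h)`! * (n + s - (t + l + h + 2))`!) = Rterm s t l h.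
  by rewrite /Rterm addn1 mulnA.
elim: g => [|g IHg] g_Gam.
  evf_big N_ge ltac:(first [ apply: evf_Lam12; lia | apply: evf_binom12; lia
    | apply: evf_Q => //; lia | apply: evf_fact12; lia ]).
  all: try by (apply: (@pow_bound_num_bound 1); [|pow_bound_auto]) || (apply: (@pow_bound_num_bound 2); [|pow_bound_auto])
    || (apply: (@pow_bound_num_bound 4); [|pow_bound_auto]).
  - by rewrite termE /Rpartial big_nat1 addn0.
  - lia.
have g_Gam' := ltnW g_Gam.
evf_big N_ge ltac:(first [ apply: evf_Lam12; lia | apply: evf_binom12; lia
  | apply: evf_Q => //; lia | apply: evf_fact12; lia
  | rewrite subn1; apply: IHg; lia ]).
all: try by (apply: (@pow_bound_num_bound 1); [|pow_bound_auto]) || (apply: (@pow_bound_num_bound 2); [|pow_bound_auto])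
  || (apply: (@pow_bound_num_bound 4); [|pow_bound_auto]) || (apply: (@pow_bound_num_bound 5) => //; apply: Rpartial_pow_bound; lia).
- by rewrite termE /Rpartial (big_nat_recr g.+1) //= addnC.
- lia.
Qed.

Lemma evf_Rsum_l l : l <= Lam t b ->
  evf "Rsum_l" [:: VNum n; vtuple b; VNum s; VNum t; VNum l]
    (VNum (\sum_(0 <= l' < l.+1) Rpartial l' (Gam s b))) (l.+1 * budget 17).
Proof.
have Lam_t := Lam_n t; have Gam_s := Gam_n s.
have [c1 c2 _ _ c5] := cost_bounds.
have c17 : (Gam s b).+1 * (2 * budget 15) + budget 15 <= budget 17.
  have -> : budget 17 = N * (N * budget 15) by rewrite /budget -!expnS.
  move: (budget 15) => y.
  rewrite mulnA mulnA -mulSnr leq_mul2r; apply/orP; right; nia.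
elim: l => [|l IHl] l_Lam.
  evf_big N_ge ltac:(first [ apply: evf_Gam12; lia | apply: evf_Rsum_g; lia]).
  - by apply: (@pow_bound_num_bound 5) => //; apply: Rpartial_pow_bound; lia.
  - by rewrite big_nat1 addn0.
  - lia.
have sum_V l' : l' <= Lam t b -> \sum_(0 <= i < l'.+1) Rpartial i (Gam s b) <= pow_bound 6.
  move=> l'_Lam; apply: sum_pow_bound => [|i i_range]; first lia.
  by apply: Rpartial_pow_bound; lia.
evf_big N_ge ltac:(first [ apply: evf_Gam12; lia | apply: evf_Rsum_g; lia
  | rewrite subn1; apply: IHl; lia]).
- by apply: (@pow_bound_num_bound 5) => //; apply: Rpartial_pow_bound; lia.
- by apply: (@pow_bound_num_bound 6) => //; apply: sum_V; lia.
- by rewrite [in RHS]big_nat_recr //= addnC.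
- lia.
Qed.

Lemma Rsum_partial : Rsum n b s t = \sum_(0 <= l < (Lam t b).+1) Rpartial l (Gam s b).
Proof. by []. Qed.

Lemma Rsum_pow_bound : Rsum n b s t <= pow_bound 6.
Proof.
have Lam_t := Lam_n t; have Gam_s := Gam_n s.
rewrite Rsum_partial; apply: sum_pow_bound => [|i i_range]; first lia.
by apply: Rpartial_pow_bound; lia.
Qed.

Lemma evf_Rsum :
  evf "Rsum" [:: VNum n; vtuple b; VNum s; VNum t] (VNum (Rsum n b s t)) (budget 19).
Proof.
have Lam_t := Lam_n t.
have [c1 c2 _ _ c5] := cost_bounds.
evf_big N_ge ltac:(first [ apply: evf_Lam12; lia | apply: evf_Rsum_l; lia]).
- by [].
- have -> : budget 19 = N * N * budget 17 by rewrite /budget -mulnA -!expnS.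
  have : budget 15 <= budget 17 by rewrite leq_pexp2l //; lia.
  have : (Lam t b + 10) * budget 17 <= N * N * budget 17.
    by rewrite leq_mul2r; apply/orP; right; nia.
  lia.
Qed.

End Terms.
End Formula.

Section FormulaSum.
Local Open Scope string_scope.
Local Open Scope nat_scope.
Variables (N n : nat) (b : seq nat).
Hypothesis N_ge : 100 <= N.
Hypothesis n_N : 4 * n + 100 <= N.
Hypothesis b_sorted : sorted leq b.
Hypothesis b_pos : all (leq 1) b.
Hypothesis b_n : all (leq^~ n) b.
Hypothesis size_b : size b <= n.
Variable x : nat.
Hypothesis x_range : 0 < x <= n.

Definition tterm s t := (t - x + 1) * Q b s t (t.+1 - s) * Rsum n b s t.
Definition tsum s t := \sum_(x <= t' < t.+1) tterm s t'.

Lemma tterm_pow_bound s t : 0 < s <= n -> t < n -> tterm s t <= pow_bound N 8.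
Proof.
move=> s_range t_n; rewrite /tterm; apply: (@pow_boundM N 2 6); last exact: (Rsum_pow_bound N_ge).
by apply: (@pow_boundM N 1 1); [apply: (leq_pow_bound N_ge); lia | apply: (Q_pow_bound N_ge); lia].
Qed.

Lemma tsum_pow_bound s t : 0 < s <= n -> t < n -> tsum s t <= pow_bound N 9.
Proof.
move=> s_range t_n; apply: (sum_pow_bound N_ge) => [|t' t'_range]; first lia.
by apply: tterm_pow_bound => //; lia.
Qed.

Lemma leq_budgetS k : 100 * budget N k <= budget N k.+1.
Proof. by rewrite /budget expnS leq_mul2r N_ge orbT. Qed.

Lemma evf_formula_t s t : 0 < s <= x -> t < n ->
  evf "formula_t" [:: VNum n; VNum x; vtuple b; VNum s; VNum t] (VNum (tsum s t))
    (t.+1 * budget N 20).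
Proof.
move=> s_range.
have s_n : 0 < s <= n by lia.
have b_N : all (leq^~ N) b by apply: sub_all b_n => y /=; lia.
have b_size_N : size b <= N by lia.
have op_cost_ge := op_cost_ge N_ge.
have [c1 c2 _ _ c3] := cost_bounds N_ge.
have c4 : budget N 15 <= budget N 19 by rewrite leq_pexp2l //; lia.
have c5 := leq_budgetS 19.
elim: t => [|t IHt] t_n.
  (* As x >= 1, t = 0 lies below the range of summation, so the program stops here and never needs t
     - 1. *)
  eapply evf_intro; [reflexivity | reflexivity | cbn [zip] | | ].
  - by eapply ev_if_holds;
      [ev_auto ltac:(arith_big N_ge) fail | lia | ev_auto ltac:(arith_big N_ge) fail].
  - by rewrite /tsum big_geq //; lia.
  - lia.
case: (ltnP t.+1 x) => [t_x|x_t].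
  eapply evf_intro; [reflexivity | reflexivity | cbn [zip] | | ].
  - by eapply ev_if_holds;
      [ev_auto ltac:(arith_big N_ge) fail | lia | ev_auto ltac:(arith_big N_ge) fail].
  - by rewrite /tsum big_geq //; lia.
  - lia.
have t_n' : t < n by lia.
eapply evf_intro; [reflexivity | reflexivity | cbn [zip] | | ].
- eapply ev_if_fails; [ev_auto ltac:(arith_big N_ge) fail | lia | ].
  ev_auto ltac:(arith_big N_ge) ltac:(first [ apply: (evf_Q N_ge) => //; lia
    | apply: (evf_Rsum N_ge) => //; lia | rewrite subn1; exact: IHt ]).
  + by apply: (@pow_bound_num_bound N N_ge 1) => //; apply: (Q_pow_bound N_ge); lia.
  + apply: (@pow_bound_num_bound N N_ge 2) => //; apply: (@pow_boundM N 1 1); last by apply: (Q_pow_bound N_ge); lia.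
    by apply: (leq_pow_bound N_ge); lia.
  + by apply: (@pow_bound_num_bound N N_ge 6) => //; apply: (Rsum_pow_bound N_ge) => //; lia.
  + by apply: (@pow_bound_num_bound N N_ge 8) => //; rewrite (addn1 t.+1); apply: tterm_pow_bound.
  + by apply: (@pow_bound_num_bound N N_ge 9) => //; apply: tsum_pow_bound.
- by rewrite /tsum [in RHS]big_nat_recr //= addnC (addn1 t.+1).
- lia.
Qed.

Definition ssum s := \sum_(1 <= s' < s.+1) tsum s' n.-1.

Lemma ssum_pow_bound s : s <= n -> ssum s <= pow_bound N 10.
Proof.
move=> s_n; apply: (sum_pow_bound N_ge) => [|s' s'_range]; first lia.
by apply: tsum_pow_bound; lia.
Qed.

Lemma evf_formula_s s : s <= x ->
  evf "formula_s" [:: VNum n; VNum x; vtuple b; VNum s] (VNum (ssum s)) (s.+1 * budget N 22).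
Proof.
have op_cost_ge := op_cost_ge N_ge.
have [c1 c2 _ _ c3] := cost_bounds N_ge.
have n_N' : n <= N by lia.
have t_cost : n.-1.+1 * budget N 20 <= budget N 21 by rewrite prednK ?[budget N 21]expnS ?leq_mul2r; lia.
have c5 := leq_budgetS 21.
have c6 : budget N 12 <= budget N 21 by rewrite leq_pexp2l //; lia.
elim: s => [|s IHs] s_x.
  evf_big N_ge fail.
  - by rewrite /ssum big_geq.
  - lia.
evf_big N_ge ltac:(first [ apply: evf_formula_t; lia | rewrite subn1; apply: IHs; lia ]).
- by apply: (@pow_bound_num_bound N N_ge 9) => //; apply: tsum_pow_bound; lia.
- by apply: (@pow_bound_num_bound N N_ge 10) => //; apply: ssum_pow_bound; lia.
- by rewrite /ssum [in RHS]big_nat_recr //= addnC subn1.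
- rewrite subn1; lia.
Qed.

End FormulaSum.

Section Main.
Local Open Scope string_scope.
Local Open Scope nat_scope.
Variables (N n : nat) (a : seq nat).
Hypothesis N_ge : 100 <= N.
Hypothesis n_N : 4 * n + 100 <= N.
Hypothesis size_a : size a = n.
Hypothesis a_range : all (fun x => 0 < x <= n) a.

Let a' := rearrangement a.

Let a'_a : perm_eq a' a.
Proof. by rewrite perm_sort. Qed.

Let size_a' : size a' = n.
Proof. by rewrite (perm_size a'_a). Qed.

Let a'_sorted : sorted leq a'.
Proof. exact: sort_sorted leq_total a. Qed.

Let a'_range : all (fun x => 0 < x <= n) a'.
Proof. by rewrite (perm_all _ a'_a). Qed.

Lemma subseq_remove_at b i : subseq (remove_at b i) b.
Proof.
rewrite /remove_at -{3}(cat_take_drop i b) cat_subseq //.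
by rewrite -addn1 addnC -drop_drop drop_subseq.
Qed.

Lemma evf_formula i : i < n ->
  evf "formula" [:: VNum n; vtuple a'; VNum i] (VNum (formula_sum n a' i)) (budget N 24).
Proof.
move=> i_n; have i_a' : i < size a' by rewrite size_a'.
have [x_gt0 x_n] := andP (allP a'_range _ (mem_nth 0 i_a')).
set b := remove_at a' i; set x := nth 0 a' i in x_gt0 x_n *.
have b_sub : subseq b a' := subseq_remove_at a' i.
have b_sorted : sorted leq b := subseq_sorted leq_trans b_sub a'_sorted.
have b_range : all (fun x => 0 < x <= n) b.
  by apply/allP => y /(mem_subseq b_sub); apply: (allP a'_range).
have b_pos : all (leq 1) b by apply: sub_all b_range => y /andP[].
have b_n : all (leq^~ n) b by apply: sub_all b_range => y /andP[].
have b_size : size b <= n by rewrite -size_a' size_subseq.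
have op_cost_ge := op_cost_ge N_ge.
have [c1 c2 _ c3 c4] := cost_bounds N_ge.
have c5 : budget N 15 <= budget N 22 by rewrite leq_pexp2l //; lia.
have c6 : x.+1 * budget N 22 <= budget N 23 by rewrite [budget N 23]expnS leq_mul2r; lia.
have c7 := leq_budgetS N_ge 23; have c8 := leq_budgetS N_ge 22.
have i_cost : i.+1 * (20 * N) <= N.+1 * (20 * N) by rewrite leq_mul2r; lia.
have n_N' : n <= N by lia.
evf_big N_ge ltac:(first [ apply: (evf_nth N_ge); rewrite size_a'; lia
  | apply: (evf_remove_at N_ge); rewrite size_a'; lia
  | apply: (evf_formula_s N_ge n_N b_sorted b_pos b_n b_size _ (leqnn x)); lia ]).
- congr VNum; rewrite /ssum /formula_sum -/b -/x.
  by apply: eq_bigr => s _; rewrite /tsum prednK //; lia.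
- lia.
Qed.

End Main.

(** * Independence of the rank function *)

Lemma nth_sorted_count s x i : sorted leq s ->
  count (fun y => y < x) s <= i < count (fun y => y < x) s + count_mem x s -> nth 0 s i = x.
Proof.
elim: s i => [|y s IHs] i ys_sorted; first by rewrite /= addn0; lia.
have y_s := allP (sorted_leq_all ys_sorted); have s_sorted := path_sorted ys_sorted.
have lt0 : x <= y -> count (fun z => z < x) s = 0.
  move=> x_y; apply/eqP; rewrite eqn0Ngt -has_count; apply/hasPn => z /y_s y_z.
  by rewrite -leqNgt (leq_trans x_y).
have eq0 : x < y -> count_mem x s = 0.
  move=> x_y; apply/eqP; rewrite eqn0Ngt -has_count; apply/hasPn => z /y_s y_z /=.
  by rewrite neq_ltn (leq_trans x_y y_z) orbT.
have [y_x|x_y|y_x] := ltngtP y x.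
- rewrite /= y_x (ltn_eqF y_x) add0n add1n; case: i => // i i_range.
  by apply: IHs => //; lia.
- by rewrite /= (lt0 (ltnW x_y)) (eq0 x_y) ltnNge (ltnW x_y) (gtn_eqF x_y); lia.
have c0 := lt0 (eq_leq (esym y_x)).
rewrite y_x /= ltnn eqxx c0 add0n add1n; case: i => // i i_range.
by apply: IHs => //; rewrite c0.
Qed.

(** Both results are sorted and are permutations of each other. *)
Lemma remove_at_nth s i j : sorted leq s -> i < size s -> j < size s ->
  nth 0 s i = nth 0 s j -> remove_at s i = remove_at s j.
Proof.
move=> s_sorted i_s j_s eq_nth; apply: (sorted_eq leq_trans anti_leq).
- by apply: (subseq_sorted leq_trans _ s_sorted); apply: subseq_remove_at.
- by apply: (subseq_sorted leq_trans _ s_sorted); apply: subseq_remove_at.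
rewrite -(perm_cons (nth 0 s i)) (perm_trans (perm_remove_at i_s)) //.
by rewrite perm_sym eq_nth perm_remove_at.
Qed.

Section RankOf.
Variables (n : nat) (a : seq nat).
Hypothesis size_a : size a = n.

(** The rank that the program computes, with ties broken by order of appearance. *)
Definition rank_of m := let x := nth 0 a m in
  count (fun y => y < x) a + count_mem x (take m a).

Lemma rank_of_count m : m < n ->
  rank_of m < count (fun y => y < nth 0 a m) a + count_mem (nth 0 a m) a.
Proof.
move=> m_n; rewrite /rank_of ltn_add2l -[X in _ < count _ X](cat_take_drop m a) count_cat.
by rewrite (drop_nth 0) ?size_a //= eqxx; lia.
Qed.

Lemma rank_of_lt m : m < n -> rank_of m < n.
Proof.
move=> /rank_of_count /leq_trans; apply; rewrite -size_a -count_predUI.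
rewrite [X in _ + X](_ : _ = 0) ?addn0 ?count_size //.
by rewrite (eq_count (a2 := pred0)) ?count_pred0 // => y /=; lia.
Qed.

Lemma nth_rank_of m : m < n -> nth 0 (rearrangement a) (rank_of m) = nth 0 a m.
Proof.
move=> m_n; apply: nth_sorted_count; first exact: sort_sorted leq_total a.
have perm_a : perm_eq (rearrangement a) a by rewrite perm_sort.
rewrite !(seq.permP perm_a) rank_of_count // andbT.
exact: leq_addr.
Qed.

Lemma formula_sum_rank_of m i : m < n -> i < n ->
  nth 0 (rearrangement a) i = nth 0 a m ->
  formula_sum n (rearrangement a) (rank_of m) = formula_sum n (rearrangement a) i.
Proof.
move=> m_n i_n eq_nth; have rank_n := rank_of_lt m_n.
have size_a' : size (rearrangement a) = n by rewrite size_sort.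
rewrite /formula_sum nth_rank_of // eq_nth.
rewrite (@remove_at_nth _ (rank_of m) i) ?size_a' ?nth_rank_of //.
exact: sort_sorted leq_total a.
Qed.

End RankOf.

(** * The main function of the program *)

Section Main.
Local Open Scope string_scope.
Local Open Scope nat_scope.
Variables (N n : nat) (a : seq nat).
Hypothesis N_ge : 100 <= N.
Hypothesis n_N : 4 * n + 100 <= N.
Hypothesis size_a : size a = n.
Hypothesis a_range : all (fun x => 0 < x <= n) a.

Definition entries (m k : nat) : value :=
  vlist [seq vfrac (formula_sum n (rearrangement a) (rank_of a i)) n`! | i <- iota m k].

(** The argument [seen] is a reversed prefix because entries are put in front of it; only
    occurrences are counted in it, so the order does not matter. *)
Lemma evf_shapley_from m k : m + k = n ->
  evf "shapley_from" [:: VNum n; vtuple a; vtuple (rearrangement a); vtuple (drop m a);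
      vtuple (rev (take m a))] (entries m k) (k.+1 * budget N 25).
Proof.
have op_cost_ge := op_cost_ge N_ge.
have [c1 c2 c2' c3 c4] := cost_bounds N_ge.
have c5 := leq_budgetS N_ge 24.
have c6 : budget N 12 <= budget N 24 by rewrite leq_pexp2l //; lia.
have fact_cost : n.+1 * (4 * op_cost N) <= budget N 12.
  by apply: leq_trans c2'; apply: leq_mul; lia.
have list_cost l : size l <= n -> (@size nat l).+1 * (20 * N) <= budget N 12.
  by move=> l_n; apply: leq_trans c3; apply: leq_mul; lia.
have a_N : all (leq^~ N) a by apply: sub_all a_range => y /andP[_]; lia.
have n_N' : n <= N by lia.
elim: k m => [|k IHk] m m_k.
  rewrite drop_oversize; last by rewrite size_a; lia.
  by evf_big N_ge fail => //; lia.
have m_n : m < n by lia.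
have x_N : nth 0 a m <= N by apply: (allP a_N); rewrite mem_nth ?size_a.
have rank_n := rank_of_lt size_a m_n.
have take_N : all (leq^~ N) (rev (take m a)).
  by rewrite all_rev; apply/allP => y /mem_take; apply: (allP a_N).
have size_take : size (rev (take m a)) <= n.
  by rewrite size_rev size_takel ?size_a; lia.
have size_a_n : size a <= n by rewrite size_a.
have count_take : count_mem (nth 0 a m) (rev (take m a)) = count_mem (nth 0 a m) (take m a).
  by rewrite count_rev.
have a_cost := list_cost a size_a_n; have take_cost := list_cost _ size_take.
rewrite (drop_nth 0) ?size_a //.
have m_k' : m.+1 + k = n by lia.
have rec := IHk m.+1 m_k'; rewrite (take_nth 0) ?size_a // rev_rcons in rec.
evf_big N_ge ltac:(first [ apply: (evf_count_lt N_ge) => //; lia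
  | apply: (evf_count_eq N_ge) => //; lia
  | rewrite count_take; apply: (evf_formula N_ge n_N size_a a_range); exact: rank_n
  | apply: (evf_fact N_ge); lia
  | exact: rec ]).
- apply: (leq_num_bound N_ge); apply: leq_trans (leq_trans (leq_addr _ _) (ltnW rank_n)) _; lia.
- rewrite count_take; apply: (leq_num_bound N_ge).
  apply: leq_trans (leq_trans (leq_addl _ _) (ltnW rank_n)) _; lia.
- by [].
- lia.
Qed.

Lemma evf_main : evf "main" [:: VNum n; vtuple a] (entries 0 n) (budget N 27).
Proof.
have a_N : all (leq^~ N) a by apply: sub_all a_range => y /andP[_]; lia.
have size_a_N : size a <= N by lia.
have [c1 c2 c2' c3 c4] := cost_bounds N_ge.
have rec := evf_shapley_from (erefl n : 0 + n = n); rewrite drop0 take0 in rec.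
evf_big N_ge ltac:(first [ apply: (evf_sort N_ge) => //; lia | exact: rec ]).
- by [].
have : (size a).+1 * ((size a).+1 * (20 * N)) <= budget N 13.
  rewrite [budget N 13]expnS leq_mul ?size_a //; first lia.
  by apply: leq_trans c3; apply: leq_mul; lia.
have c13 : budget N 13 <= budget N 25 by rewrite leq_pexp2l //; lia.
have : n.+1 * budget N 25 <= budget N 26 by rewrite [budget N 26]expnS leq_mul2r; lia.
have := leq_budgetS N_ge 25; have := leq_budgetS N_ge 26; have : 100 <= budget N 13.
  by rewrite (leq_trans N_ge) // -{1}(expn1 N) leq_pexp2l //; lia.
lia.
Qed.

End Main.

Lemma runs_shapley n (a : n.-tuple nat) (r : {perm 'I_n}) :
  PF n n a -> is_rank a r ->
  exists2 time : nat,
    runs shapley_program [:: VNum n; vtuple a]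
      (vlist [seq vfrac (formula_sum n (rearrangement a) (r j)) n`! | j <- enum 'I_n]) time
    & time <= (4 * n + 100) ^ 27.
Proof.
rewrite PF_E => /and3P[/eqP size_a a_range _] r_rank.
have N_ge : 100 <= 4 * n + 100 by exact: leq_addl.
have [params [body [eq_f size_ps [fuel [time [eq_v time_le]]]]]] :=
  evf_main N_ge (leqnn _) size_a a_range.
exists time => //; exists fuel, params, body; split=> //.
rewrite eq_v; congr (Some (vlist _, _)).
rewrite -val_enum_ord -map_comp; apply: eq_map => j /=; congr vfrac.
(* The program uses its own ranks, while [r] may break ties differently; the values of the formula
   coincide. *)
apply: (formula_sum_rank_of size_a) => //.
by have := r_rank j; rewrite (tnth_nth 0) => ->.
Qed.

Lemma horner_nat (c d k n : nat) :
  ((c%:P * 'X + d%:P) ^+ k : {poly nat}).[n]%R = (c * n + d) ^ k.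
Proof.
rewrite horner_exp hornerD hornerM hornerX !hornerC.
by elim: k => // k IHk; rewrite GRing.exprS IHk expnS.
Qed.

Theorem theorem3p10 :
  (forall (b : seq nat) (s t k : nat),
     sorted leq b -> all (leq 1) b -> 0 < s ->
     Q b s t k = Q_recursion b s t k)
  /\
  exists P : {poly nat},
    forall (n : nat) (a : n.-tuple nat), 0 < n -> PF n n a ->
      (exists r : {perm 'I_n}, is_rank a r)
      /\
      forall r : {perm 'I_n}, is_rank a r ->
        (forall (R : realType) (j : 'I_n),
           shapley (fun S : {set 'I_n} => (game_cost a S)%:R%R : R) j
           = ((n`!)%:R^-1 * (formula_sum n (rearrangement a) (r j))%:R)%R)
        /\
        exists2 time : nat,
          runs shapley_program [:: VNum n; vtuple a]
            (vlist [seq vfrac (formula_sum n (rearrangement a) (r j)) n`!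
                   | j <- enum 'I_n])
            time
          & time <= P.[n]%R.
Proof.
split; first by move=> b s t k; apply: Q_recursionE.
exists ((4%N%:P * 'X + 100%N%:P) ^+ 27)%R => n a n_gt0 aPF; split; first exact: rank_exists.
move=> r r_rank; split; first by move=> R j; apply: shapley_formula.
have [time run time_le] := runs_shapley aPF r_rank; exists time => //.
by rewrite horner_nat.
Qed.
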